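(* Let $(M,\Pi)$ be a compact regular Poisson manifold with $2$-dimensional symplectic leaves, with characteristic foliation $\mathcal F$, and let $G$ be a distribution complementary to $T\mathcal F$. If an infinitesimal deformation $Z\in\mathfrak X^2_{\mathcal F}(M)$ of $\Pi$ is such that $\phi(Z)$ is unobstructed, then $Z$ itself is unobstructed. In particular, if the deformation problem of the underlying foliation $\mathcal F$ is unobstructed, then also the deformation problem of $\Pi$ as a rank-$2$ Poisson structure is unobstructed.
   Context: $\Pi$ is a Poisson bivector field with $\Pi^\sharp(\eta)=\iota_\eta\Pi$ of constant rank (here $2$); $T\mathcal F=\operatorname{im}\Pi^\sharp$, $T^\circ\mathcal F=\ker\Pi^\sharp$ its annihilator; the leafwise symplectic form $\omega\in\Gamma(\wedge^2T^*\mathcal F)$ satisfies $\Pi=-\omega^{-1}$, i.e. $\Pi^\sharp$ induces $-(\omega^\flat)^{-1}:T^*\mathcal F\to T\mathcal F$, $\omega^\flat(X)=\iota_X\omega$. $N\mathcal F=TM/T\mathcal F\cong G$, $N^*\mathcal F\cong T^\circ\mathcal F\cong G^*$. Good bivector fields: $\mathfrak X^2_{\mathcal F}(M)=\{W\in\mathfrak X^2(M):W(\alpha,\beta)=0\ \forall\alpha,\beta\in\Gamma(T^\circ\mathcal F)\}$. An infinitesimal deformation of $\Pi$ (as regular Poisson structure) is $Z\in\mathfrak X^2_{\mathcal F}(M)$ with $d_\Pi Z=[\Pi,Z]_{SN}=0$. It is unobstructed if there is a smooth path $\Pi_t$ ($t$ in an open interval around $0$) of regular Poisson structures of the same rank as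 $\Pi$ with $\Pi_0=\Pi$ and $\frac{d}{dt}|_{t=0}\Pi_t=Z$. An infinitesimal deformation of $\mathcal F$ is $\eta\in\Omega^1(\mathcal F;N\mathcal F)=\Gamma(T^*\mathcal F\otimes N\mathcal F)$ with $d_\nabla\eta=0$, where $d_\nabla$ is the leafwise de Rham differential for the Bott connection $\nabla_X\overline Y=\overline{[X,Y]}$. It is unobstructed if there is a smooth path $\mathcal F_t$ of foliations of the same rank with $\mathcal F_0=\mathcal F$ such that, writing $T\mathcal F_t=\{V+\eta_t(V):V\in T\mathcal F\}$ for small $t$ with $\eta_t\in\Gamma(T^*\mathcal F\otimes G)$, one has $\frac{d}{dt}|_{t=0}\eta_t=\eta$. A deformation problem (of $\mathcal F$ or of $\Pi$) is unobstructed if all infinitesimal deformations are unobstructed. $\phi$ maps $Z\in\mathfrak X^2_{\mathcal F}(M)$ to $\phi(Z)\in\Omega^1(\mathcal F;N\mathcal F)$ given by $\beta(\phi(Z)(X))=-Z(\omega^\flat X,\beta)$ for $X\in\Gamma(T\mathcal F)$, $\beta\in\Gamma(N^*\mathcal F)\cong\Gamma(G^* )$, where $\omega^\flat X\in T^*\mathcal F\cong G^\circ$. It sends infinitesimal deformations of $\Pi$ to infinitesimal deformations of $\mathcal F$. *)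

(* Defs.v *)
From HB Require Import structures.
From mathcomp Require Import all_boot all_order all_algebra.
From mathcomp Require Import all_classical all_reals all_analysis.

Set Implicit Arguments.
Unset Strict Implicit.
Unset Printing Implicit Defensive.
Import Order.TTheory GRing.Theory Num.Theory.
Import numFieldNormedType.Exports.

Local Open Scope classical_set_scope.
Local Open Scope ring_scope.

(* C^k on U; only used for U open and V finite dimensional. *)
Fixpoint Ck (R : realType) (V W : normedModType R) (k : nat) (U : set V)
    (f : V -> W) : Prop :=
  if k is k'.+1 then
    (forall x, U x -> differentiable f x) /\ (forall v, Ck k' U ('D_v f))
  else forall x, U x -> {for x, continuous f}.

Definition smooth (R : realType) (V W : normedModType R) (U : set V)
  (f : V -> W) := forall k, Ck k U f.

(* Smooth manifolds without boundary.  Second countability is not required: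
   it is automatic in the compact case. *)
Record manifold (R : realType) (n : nat) := Manifold {
  point :> topologicalType;
  chart : Type;
  dom : chart -> set point;
  cmap : chart -> point -> 'rV[R]_n;
  cinv : chart -> 'rV[R]_n -> point;
  manifold_hausdorff : hausdorff_space point;
  chart_cover : forall p, exists c, dom c p;
  open_dom : forall c, open (dom c);
  open_codom : forall c, open (cmap c @` dom c);
  cmapK : forall c p, dom c p -> cinv c (cmap c p) = p;
  cmap_continuous : forall c p, dom c p -> {for p, continuous (cmap c)};
  cinv_continuous : forall c u, (cmap c @` dom c) u ->
    {for u, continuous (cinv c)};
  transition_smooth : forall c d,
    smooth (cmap c @` (dom c `&` dom d)) (cmap d \o cinv c)
}.

Section Tensors.
Context (R : realType) (n : nat) (M : manifold R n).

(* Every point p is given a preferred chart, and T_pM is identified with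
   'rV[R]_n by the coordinate basis of that chart at p; T*_pM is identified
   with 'rV[R]_n by the dual basis, so that alpha(X) = alpha *m X^T.  These
   bases need not vary continuously with p: smoothness of a field is always
   tested on its components in the charts of the atlas. *)
Definition chart_at (p : M) : chart M := projT1 (cid (chart_cover p)).

(* Change of basis from the preferred chart at p to the chart c: the
   components in c of a tangent vector X at p are X *m jac c p. *)
Definition jac (c : chart M) (p : M) : 'M[R]_n :=
  jacobian (cmap c \o cinv (chart_at p)) (cmap (chart_at p) p).

(* An m-tuple of tangent vectors (the rows of A); a bivector W, with
   W(alpha, beta) = alpha *m W *m beta^T; an endomorphism E, acting by
   X |-> X *m E. *)
Definition vec_in m (c : chart M) (p : M) (A : 'M[R]_(m, n)) : 'M[R]_(m, n) :=
  A *m jac c p.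
Definition biv_in (c : chart M) (p : M) (W : 'M[R]_n) : 'M[R]_n :=
  (jac c p)^T *m W *m jac c p.
Definition end_in (c : chart M) (p : M) (E : 'M[R]_n) : 'M[R]_n :=
  invmx (jac c p) *m E *m jac c p.

(* The components in the chart c of a field S, as a function on 'rV[R]_n
   (meaningful on cmap c @` dom c). *)
Definition rep (W1 W2 : Type) (comp : chart M -> M -> W1 -> W2) (c : chart M)
    (S : M -> W1) (u : 'rV[R]_n) : W2 :=
  comp c (cinv c u) (S (cinv c u)).

Definition smooth_field (W1 : Type) (W2 : normedModType R)
    (comp : chart M -> M -> W1 -> W2) (U : set M) (S : M -> W1) : Prop :=
  forall c, smooth (cmap c @` (dom c `&` U)) (rep comp c S).

(* Joint smoothness on J * U of a time-dependent field. *)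
Definition smooth_path (W1 : Type) (W2 : normedModType R)
    (comp : chart M -> M -> W1 -> W2) (J : set R) (U : set M)
    (S : R -> M -> W1) : Prop :=
  forall c, @smooth R (R^o * 'rV[R]_n)%type W2
    (J `*` (cmap c @` (dom c `&` U))) (fun tu => rep comp c (S tu.1) tu.2).

(* [X, Y] = X^j (d_j Y) - Y^j (d_j X) in the preferred chart at p. *)
Definition lie (X Y : M -> 'rV[R]_n) (p : M) : 'rV[R]_n :=
  let c := chart_at p in
  'D_(X p) (rep (@vec_in 1) c Y) (cmap c p)
  - 'D_(Y p) (rep (@vec_in 1) c X) (cmap c p).

(* [P, Z]^{ijk} is the cyclic sum over (i, j, k) of
   P^{il} (d_l Z^{jk}) + Z^{il} (d_l P^{jk}), in the preferred chart at p.
   (Only the vanishing of the bracket is used, so that sign and normalization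
   conventions are immaterial.) *)
Definition schouten (P Z : M -> 'M[R]_n) (p : M) (i j k : 'I_n) : R :=
  let c := chart_at p in
  let cyc i j k := ('D_(row i (P p)) (rep biv_in c Z) (cmap c p)) j k
                   + ('D_(row i (Z p)) (rep biv_in c P) (cmap c p)) j k in
  cyc i j k + cyc j k i + cyc k i j.

(* A distribution is a field D of square matrices; its fiber at p is the row
   space of D p, and different matrices may encode the same distribution. *)

Definition smooth_distribution (r : nat) (D : M -> 'M[R]_n) : Prop :=
  forall p, exists U : set M, exists X : M -> 'M[R]_(r, n),
    [/\ open U, U p, smooth_field (@vec_in r) U X &
        forall q, U q -> \rank (X q) = r /\ (D q :=: X q)%MS].

Definition complementary (D G : M -> 'M[R]_n) : Prop :=
  forall p, (D p + G p :=: 1%:M)%MS /\ (D p :&: G p)%MS = 0.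

Definition involutive (D : M -> 'M[R]_n) : Prop :=
  forall (U : set M) (X Y : M -> 'rV[R]_n), open U ->
    smooth_field (@vec_in 1) U X -> smooth_field (@vec_in 1) U Y ->
    (forall q, U q -> (X q <= D q)%MS) -> (forall q, U q -> (Y q <= D q)%MS) ->
    forall q, U q -> (lie X Y q <= D q)%MS.

(* The row space of ann D p consists of the covectors vanishing on D p. *)
Definition ann (D : M -> 'M[R]_n) (p : M) : 'M[R]_n := kermx (D p)^T.

Definition bivector_field (W : M -> 'M[R]_n) : Prop :=
  (forall p, (W p)^T = - W p) /\ smooth_field biv_in setT W.

(* Pi^#(alpha) = alpha *m P p, so that the rank of Pi at p is \rank (P p) and
   the characteristic distribution im Pi^# is the row space of P: below, P
   itself plays the role of T F, and ann P that of the annihilator of T F. *)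
Definition regular_poisson (r : nat) (P : M -> 'M[R]_n) : Prop :=
  [/\ bivector_field P, forall p i j k, schouten P P p i j k = 0 &
      forall p, \rank (P p) = r].

Definition good_bivector (P W : M -> 'M[R]_n) : Prop :=
  forall p (a b : 'rV[R]_n), (a <= ann P p)%MS -> (b <= ann P p)%MS ->
    a *m W p *m b^T = 0.

Definition poisson_inf_def (P Z : M -> 'M[R]_n) : Prop :=
  [/\ bivector_field Z, good_bivector P Z &
      forall p i j k, schouten P Z p i j k = 0].

Definition poisson_unobstructed (r : nat) (P Z : M -> 'M[R]_n) : Prop :=
  exists (e : R) (Pt : R -> M -> 'M[R]_n),
    [/\ 0 < e,
        smooth_path biv_in [set t | `|t| < e] setT Pt,
        forall t, `|t| < e -> regular_poisson r (Pt t),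
        forall p, Pt 0 p = P p &
        forall p, is_derive (0 : R) 1 (fun t => Pt t p) (Z p)].

Definition poisson_problem_unobstructed (r : nat) (P : M -> 'M[R]_n) : Prop :=
  forall Z, poisson_inf_def P Z -> poisson_unobstructed r P Z.

(* With NF = TM/TF identified with the complement G, an element of
   T*_pF (x) N_pF is encoded as the endomorphism of T_pM extending it by 0
   on G. *)
Definition hom_at (G : M -> 'M[R]_n) (p : M) (E : 'M[R]_n) : Prop :=
  G p *m E = 0 /\ (E <= G p)%MS.

(* d_nabla eta (X, Y) = nabla_X eta(Y) - nabla_Y eta(X) - eta([X, Y]), which
   vanishes in TM/TF. *)
Definition fol_inf_def (F G eta : M -> 'M[R]_n) : Prop :=
  [/\ smooth_field end_in setT eta,
      forall p, hom_at G p (eta p) &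
      forall X Y : M -> 'rV[R]_n,
        smooth_field (@vec_in 1) setT X -> smooth_field (@vec_in 1) setT Y ->
        (forall p, (X p <= F p)%MS) -> (forall p, (Y p <= F p)%MS) ->
        forall p, (lie X (fun q => Y q *m eta q) p
                   - lie Y (fun q => X q *m eta q) p
                   - lie X Y p *m eta p <= F p)%MS].

Definition smooth_foliation_path (r : nat) (e : R) (D : R -> M -> 'M[R]_n) :
    Prop :=
  (forall t, `|t| < e -> involutive (D t)) /\
  (forall t0 p, `|t0| < e ->
    exists (J : set R) (U : set M) (X : R -> M -> 'M[R]_(r, n)),
    [/\ open J /\ J t0, open U /\ U p, smooth_path (@vec_in r) J U X &
        forall t q, J t -> U q ->
          \rank (X t q) = r /\ (D t q :=: X t q)%MS]).

Definition fol_unobstructed (r : nat) (F G eta : M -> 'M[R]_n) : Prop :=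
  exists (e : R) (D : R -> M -> 'M[R]_n),
    [/\ 0 < e, smooth_foliation_path r e D, forall p, (D 0 p :=: F p)%MS &
      exists (d : R) (eta_ : R -> M -> 'M[R]_n),
      [/\ 0 < d <= e,
          smooth_path end_in [set t | `|t| < d] setT eta_,
          forall t p, `|t| < d -> hom_at G p (eta_ t p),
          (* D t = {V + eta_t(V) | V in F} *)
          forall t p, `|t| < d -> (D t p :=: F p *m (1%:M + eta_ t p))%MS &
          forall p, is_derive (0 : R) 1 (fun t => eta_ t p) (eta p)]].

Definition fol_problem_unobstructed (r : nat) (F G : M -> 'M[R]_n) : Prop :=
  forall eta, fol_inf_def F G eta -> fol_unobstructed r F G eta.

(* X |-> X *m omega_flat P G p is omega^flat : T_pF -> T*_pF = G_p^o; by
   omega_flatP it maps X to the unique covector alpha in G_p^o such that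
   Pi^#(alpha) = - X. *)
Definition omega_flat (P G : M -> 'M[R]_n) (p : M) : 'M[R]_n :=
  - (pinvmx (P p) *m proj_mx (ann G p) (ann P p)).

(* The defining property is phiP. *)
Definition phi (P G Z : M -> 'M[R]_n) (p : M) : 'M[R]_n :=
  proj_mx (P p) (G p) *m omega_flat P G p *m (- Z p) *m proj_mx (G p) (P p).

Section PhiP.
Variables (P G : M -> 'M[R]_n) (p : M).
Hypotheses (skewP : (P p)^T = - P p) (compl : complementary P G).

Let annP a : (a <= ann P p)%MS = (a *m P p == 0 :> 'rV[R]_n).
Proof. by rewrite sub_kermx skewP mulmxN oppr_eq0. Qed.

Let capann : (ann G p :&: ann P p)%MS = 0.
Proof.
apply/eqP; rewrite -submx0; apply/rV_subP => a.
rewrite sub_capmx => /andP[]; rewrite !sub_kermx => /eqP aG /eqP aP.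
have [/eqmxP/andP[_ /sub_addsmxP[[u v] /= def1]] _] := compl p.
have : a *m (1%:M : 'M[R]_n)^T = 0.
  by rewrite def1 linearD /= mulmxDr !trmx_mul !mulmxA aG aP !mul0mx addr0.
by rewrite trmx1 mulmx1 => ->; rewrite sub0mx.
Qed.

Let sumann : (ann G p + ann P p :=: 1%:M)%MS.
Proof.
have rk1 : (\rank (P p) + \rank (G p))%N = n.
  have [rk cap0] := compl p.
  by rewrite -mxrank_sum_cap cap0 mxrank0 addn0 rk mxrank1.
have rkle (D : M -> 'M[R]_n) : \rank (ann D p) = (n - \rank (D p))%N.
  by rewrite mxrank_ker mxrank_tr.
have : \rank (ann G p + ann P p)%MS = n.
  have := mxrank_sum_cap (ann G p) (ann P p).
  rewrite capann mxrank0 addn0 => ->; rewrite !rkle.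
  have arith (x y z : nat) : (x + y = z -> z - y + (z - x) = z)%N.
    by move=> <-; rewrite addnK addKn.
  exact: arith.
by move=> rkn; apply/eqmxP; rewrite submx1 sub1mx /row_full rkn eqxx.
Qed.

Lemma omega_flatP (X : 'rV[R]_n) : (X <= P p)%MS ->
  (X *m omega_flat P G p <= ann G p)%MS /\
  X *m omega_flat P G p *m P p = - X.
Proof.
move=> XP; rewrite /omega_flat mulmxN mulmxA; split.
  by rewrite eqmx_opp proj_mx_sub.
set a := X *m pinvmx (P p).
have : (a - a *m proj_mx (ann G p) (ann P p) <= ann P p)%MS.
  apply: proj_mx_compl_sub; rewrite sumann; exact: submx1.
rewrite annP mulmxBl subr_eq0 => /eqP aE.
by rewrite mulNmx -aE mulmxKpV.
Qed.

Lemma phiP (Z : M -> 'M[R]_n) :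
  hom_at G p (phi P G Z p) /\
  forall X b : 'rV[R]_n, (X <= P p)%MS -> (b <= ann P p)%MS ->
    b *m (X *m phi P G Z p)^T
    = - ((X *m omega_flat P G p) *m Z p *m b^T).
Proof.
have [PG1 cap0] := compl p.
have idP (X : 'rV[R]_n) : (X <= P p)%MS -> X *m proj_mx (P p) (G p) = X.
  exact: proj_mx_id.
have killG : G p *m proj_mx (P p) (G p) = 0 by exact: proj_mx_0.
have subG (w : 'rV[R]_n) : (w - w *m proj_mx (G p) (P p) <= P p)%MS.
  by apply: proj_mx_compl_sub; rewrite addsmxC PG1; exact: submx1.
split; first (split; last exact: proj_mx_sub).
  rewrite /phi; move: (proj_mx (P p) (G p)) killG (proj_mx (G p) (P p)) => Q QE.
  by move: (omega_flat P G p) => o Q'; rewrite !mulmxA QE !mul0mx.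
rewrite /phi => X b XP; rewrite annP => /eqP bP.
have PbT : P p *m b^T = 0.
  by apply: trmx_inj; rewrite trmx_mul trmxK skewP mulmxN bP oppr0 trmx0.
move: (proj_mx (P p) (G p)) (idP X XP) (proj_mx (G p) (P p)) subG => Q QE Q'.
move: (omega_flat P G p) => o subG; rewrite !mulmxA QE.
have /submxP[v /(congr1 (mulmx^~ b^T))] := subG (X *m o *m - Z p).
rewrite /= -(mulmxA v) PbT mulmx0 mulmxBl => /eqP; rewrite subr_eq0 => /eqP wE.
have sym (x y : 'rV[R]_n) : x *m y^T = y *m x^T.
  by apply/rowP => i; rewrite !ord1 !mxE; apply: eq_bigr => k _;
     rewrite !mxE mulrC.
by rewrite sym -wE mulmxN mulNmx.
Qed.

End PhiP.

End Tensors.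

(* Main.v *)
From HB Require Import structures.
Require Import Defs.
From mathcomp Require Import all_boot all_order all_algebra.
From mathcomp Require Import ring lra.
From mathcomp Require Import all_classical all_reals all_analysis.

(* If the leaves of F_t have dimension 2, every bivector field that spans
   T F_t is Poisson: its Jacobiator is an alternating 3-tensor, and by
   involutivity each of its contractions lies in the plane T F_t.  So
   it suffices to lift the path F_t = graph(eta_t) to a path of bivector fields
   with the right derivative.  Let Q be the projection onto TF along G and
   V = Q^T Z Q the tangential part of Z, so that V = f Pi for a function f.
   Then
     Pi_t = (1 + eta_t)_* (1 + t f + t^2 f^2) Pi
   has constant rank 2, as 1 + x + x^2 has no real root, and its derivative at
   t = 0 is V plus the mixed part of Z, which is determined by phi(Z).  The
   second claim follows from the first, because d_nabla phi(Z) = 0 whenever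
   [Pi, Z] = 0. *)

Set Implicit Arguments.
Unset Strict Implicit.
Unset Printing Implicit Defensive.
Import Order.TTheory GRing.Theory Num.Theory.
Import numFieldNormedType.Exports.

Local Open Scope classical_set_scope.
Local Open Scope ring_scope.

(** * Smooth maps between normed modules *)

(** The obstacle is smoothness. The projection Q, the leafwise form and the function f all arise
    pointwise, from [proj_mx], [pinvmx] and a rank argument, with no visible smooth dependence on
    the point. Q and Theta, the leafwise form extended by zero on G, are recovered as the unique
    solutions of linear systems with smooth data: P Q = P, G Q = 0, and then P Theta = - Q^T, G
    Theta = 0. The function f is never differentiated: f Pi is V and f^2 Pi is - V Theta V, products
    of smooth tensors. The summand t^2 f^2 does not change the derivative at t = 0 and keeps the
    conformal factor at least 3/4 whatever the value of t f. The map 1 + eta_t is invertible because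
    eta_t squares to zero. So the lift has rank 2 on the whole interval on which eta_t is given. *)

Section SmoothCalculus.
Context (R : realType).

Section Basics.
Context (V W : normedModType R).
Implicit Types (U : set V) (f g : V -> W).

Lemma near_eq_differentiable f g x :
  (\near x, f x = g x) -> differentiable f x -> differentiable g x.
Proof.
move=> fg df; have fgx : f x = g x by exact: (nbhs_singleton fg).
have [dfc /eqaddoP dfo] := iffLR (diff_locallyP _ _) df.
have dgo : g \o shift x = cst (g x) + 'd f x +o_ 0 id.
  have fg0 : \forall h \near (0 : V), f (h + x) = g (h + x).
    by move: fg; rewrite (near_shift 0); apply: filterS => h /=; rewrite subr0.
  apply/eqaddoP => e e0; apply: filterS2 fg0 (dfo e e0) => h fgh.
  by rewrite !fctE /= fgh fgx.
by apply/diff_locallyP; rewrite (diff_unique dfc dgo).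
Qed.

Lemma eq_Ck k U f g : open U -> (forall x, U x -> f x = g x) ->
  Ck k U f -> Ck k U g.
Proof.
move=> oU; elim: k f g => [|k IH] f g fg /=.
  move=> cf x Ux; have := cf x Ux; rewrite /prop_for /continuous_at (fg x Ux).
  apply: cvg_trans; apply: near_eq_cvg; near=> y; apply: fg.
  by near: y; exact: open_nbhs_nbhs.
have nfg x : U x -> \near x, f x = g x.
  by move=> Ux; near=> y; apply: fg; near: y; exact: open_nbhs_nbhs.
move=> [df Df]; split=> [x Ux|v].
  exact: near_eq_differentiable (nfg x Ux) (df x Ux).
by apply: IH (Df v) => x Ux; apply: near_eq_derive; exact: nfg.
Unshelve. all: by end_near. Qed.

Lemma CkS k U f : Ck k.+1 U f -> Ck k U f.
Proof.
elim: k f => [|k IH] f [df Df] /=.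
  by move=> x Ux; exact/differentiable_continuous/df.
by split=> // v; apply: IH; exact: Df.
Qed.

Lemma smooth_derive U f v : smooth U f -> smooth U ('D_v f).
Proof. by move=> sf k; have [_] := sf k.+1; apply. Qed.

Lemma smooth_differentiable U f x : smooth U f -> U x -> differentiable f x.
Proof. by move=> /(_ 1%N)[+ _]; apply. Qed.

Lemma eq_smooth U f g : open U -> (forall x, U x -> f x = g x) ->
  smooth U f -> smooth U g.
Proof. by move=> oU fg sf k; exact: eq_Ck fg (sf k). Qed.

Lemma sub_Ck k (U U' : set V) f : U' `<=` U -> Ck k U f -> Ck k U' f.
Proof.
move=> sU; elim: k f => [|k IH] f /=; first by move=> h x /sU; exact: h.
by move=> [df Df]; split=> [x /sU|v]; [exact: df|exact: IH].
Qed.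

Lemma sub_smooth (U U' : set V) f : U' `<=` U -> smooth U f -> smooth U' f.
Proof. by move=> sU sf k; exact: sub_Ck (sf k). Qed.

(** [Ck] speaks of derivatives of the total map [f] at the points of a set, so the sets [U'] need be
    neither open nor contained in [U]. *)
Lemma smooth_local U f :
  (forall x, U x -> exists2 U', U' x & smooth U' f) -> smooth U f.
Proof.
move=> loc k; elim: k f loc => [|k IH] f loc /=.
  by move=> x /loc[U' U'x /(_ 0)]; exact.
split=> [x /loc[U' U'x /(_ 1)[+ _]]|v]; first exact.
by apply: IH => x /loc[U' U'x sf]; exists U' => //; exact: smooth_derive.
Qed.

Lemma Ck_cst k U (a : W) : Ck k U (fun=> a).
Proof.
elim: k a => [|k IH] a /=; first by move=> x _; exact: cst_continuous.
split=> [x _|v]; first exact: differentiable_cst.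
have -> : 'D_v (fun=> a) = (fun=> 0 : W) :> (V -> W); last exact: IH.
by apply/funext => x; exact: derive_cst.
Qed.

Lemma Ck_add k U f g : open U -> Ck k U f -> Ck k U g ->
  Ck k U (fun x => f x + g x).
Proof.
move=> oU; elim: k f g => [|k IH] f g /=.
  by move=> cf cg x Ux; apply: continuousD; [exact: cf|exact: cg].
move=> [df Df] [dg Dg]; split=> [x Ux|v].
  by apply: differentiableD; [exact: df|exact: dg].
apply: eq_Ck (IH _ _ (Df v) (Dg v)) => // x Ux; rewrite -deriveD//.
- exact/diff_derivable/df.
- exact/diff_derivable/dg.
Qed.

Lemma Ck_sum k U I (r : seq I) (P : pred I) (F : I -> V -> W) : open U ->
  (forall i, P i -> Ck k U (F i)) ->
  Ck k U (fun x => \sum_(i <- r | P i) F i x).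
Proof.
move=> oU sF; elim: r => [|i r IH].
  by under eq_fun do rewrite big_nil; exact: Ck_cst.
under eq_fun do rewrite big_cons.
by case: (boolP (P i)) => Pi //; apply: Ck_add => //; exact: sF.
Qed.

End Basics.

(* [a] is affine with linear part [da]. *)
Lemma Ck_comp_affine (V V' W : normedModType R) k (U : set V) (U' : set V')
    (a da : V -> V') (f : V' -> W) : open U ->
  (forall x, is_diff x a da) -> (forall x, U x -> U' (a x)) ->
  Ck k U' f -> Ck k U (f \o a).
Proof.
move=> oU ada aU; elim: k f => [|k IH] f /=.
  move=> cf x Ux; apply: continuous_comp; last exact/cf/aU.
  by apply: differentiable_continuous; exact: (@ex_diff _ _ _ _ _ _ _ (ada x)).
move=> [df Df]; have dfa x : U x -> is_diff x (f \o a) ('d f (a x) \o da).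
  move=> Ux; apply: is_diff_comp.
  by apply: differentiableP; exact/df/aU.
split=> [x Ux|v]; first exact: (@ex_diff _ _ _ _ _ _ _ (dfa x Ux)).
(* Since [da] is the same at every point, ['D_v (f \o a)] is again a composite with [a], and the
   induction needs no product rule. *)
apply: eq_Ck (IH _ (Df (da v))) => // x Ux /=.
rewrite deriveE; last exact/df/aU.
rewrite deriveE; last exact: (@ex_diff _ _ _ _ _ _ _ (dfa x Ux)).
by rewrite (@diff_val _ _ _ _ _ _ _ (dfa x Ux)).
Qed.

Lemma Ck_lin (V W W' : normedModType R) k (U : set V)
    (L : {linear W -> W'}) (f : V -> W) : open U -> continuous L ->
  Ck k U f -> Ck k U (L \o f).
Proof.
move=> oU cL; have dL x := linear_differentiable x cL.
elim: k f => [|k IH] f /=.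
  by move=> cf x Ux; apply: continuous_comp; [exact: cf|exact: cL].
move=> [df Df]; split=> [x Ux|v]; first exact: differentiable_comp (df x Ux) _.
apply: eq_Ck (IH _ (Df v)) => // x Ux.
rewrite deriveE; last exact: differentiable_comp (df x Ux) _.
by rewrite diff_comp//= ?diff_lin//; [rewrite -deriveE//; exact: df|exact: df].
Qed.

Section Scalars.
Context (V : normedModType R).
Implicit Types (U : set V) (f g : V -> R).

Lemma Ck_mul k U f g : open U -> Ck k U f -> Ck k U g ->
  Ck k U (fun x => f x * g x).
Proof.
move=> oU; elim: k f g => [|k IH] f g.
  by move=> cf cg x Ux; apply: continuousM; [exact: cf|exact: cg].
move=> sf sg; have [[df Df] [dg Dg]] := (sf, sg); split=> [x Ux|v].
  by apply: differentiableM; [exact: df|exact: dg].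
have D := Ck_add oU (IH _ _ (CkS sf) (Dg v)) (IH _ _ (CkS sg) (Df v)).
apply: eq_Ck D => // x Ux; rewrite deriveM//; apply/diff_derivable.
- exact/df.
- exact/dg.
Qed.

Lemma Ck_prod k U I (r : seq I) (P : pred I) (F : I -> V -> R) : open U ->
  (forall i, P i -> Ck k U (F i)) ->
  Ck k U (fun x => \prod_(i <- r | P i) F i x).
Proof.
move=> oU sF; elim: r => [|i r IH].
  by under eq_fun do rewrite big_nil; exact: Ck_cst.
under eq_fun do rewrite big_cons.
by case: (boolP (P i)) => Pi //; apply: Ck_mul => //; exact: sF.
Qed.

Lemma Ck_inv k U f : open U -> (forall x, U x -> f x != 0) -> Ck k U f ->
  Ck k U (fun x => (f x)^-1).
Proof.
move=> oU f0; elim: k => [|k IH].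
  by move=> cf x Ux; apply: continuousV; [exact: f0|exact: cf].
move=> sf; have [df Df] := sf; split=> [x Ux|v].
  by apply: differentiableV; [exact: df|exact: f0].
have sV := IH (CkS sf).
have D := Ck_mul oU (Ck_mul oU (Ck_cst k U (-1 : R)) (Ck_mul oU sV sV)) (Df v).
apply: eq_Ck D => // x Ux.
have dfv : derivable f x v by exact/diff_derivable/df.
by rewrite deriveV ?f0// -invfM -expr2 mulN1r.
Qed.

End Scalars.

Section Matrices.
Context (V : normedModType R).
Implicit Type U : set V.

Lemma Ck_coord k U m n (f : V -> 'M[R]_(m, n)) i j : open U ->
  Ck k U f -> Ck k U (fun x => f x i j : R).
Proof.
move=> oU; pose L (A : 'M[R]_(m, n)) : R := A i j.
have L_lin : linear L by move=> a A B; rewrite /L !mxE.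
pose LM := GRing.isLinear.Build _ _ _ _ L L_lin.
pose LL : {linear _ -> _} := HB.pack L LM.
by apply: (@Ck_lin _ _ _ k U LL) => //; exact: coord_continuous.
Qed.

Lemma Ck_mx k U m n (f : V -> 'M[R]_(m, n)) : open U ->
  (forall i j, Ck k U (fun x => f x i j : R)) -> Ck k U f.
Proof.
move=> oU sf.
have -> : f = fun x => \sum_i \sum_j f x i j *: delta_mx i j.
  by apply/funext => x; exact: matrix_sum_delta.
apply: Ck_sum => // i _; apply: Ck_sum => // j _.
pose L (a : R) : 'M[R]_(m, n) := a *: delta_mx i j.
have L_lin : linear L by move=> a b c; rewrite /L scalerDl scalerA.
pose LM := GRing.isLinear.Build _ _ _ _ L L_lin.
pose LL : {linear _ -> _} := HB.pack L LM.
by apply: (@Ck_lin _ _ _ k U LL) => //; exact: scalel_continuous.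
Qed.

Lemma Ck_mulmx k U m n p (f : V -> 'M[R]_(m, n)) (g : V -> 'M[R]_(n, p)) :
  open U -> Ck k U f -> Ck k U g -> Ck k U (fun x => f x *m g x).
Proof.
move=> oU sf sg; apply: Ck_mx => // i j; under eq_fun do rewrite mxE.
by apply: Ck_sum => // l _; apply: Ck_mul => //; exact: Ck_coord.
Qed.

Lemma Ck_det k U n (f : V -> 'M[R]_n) : open U ->
  Ck k U f -> Ck k U (fun x => \det (f x)).
Proof.
move=> oU sf; apply: Ck_sum => // s _; apply: Ck_mul => //; first exact: Ck_cst.
by apply: Ck_prod => // i _; exact: Ck_coord.
Qed.

Lemma Ck_invmx k U n (f : V -> 'M[R]_n) : open U ->
  (forall x, U x -> f x \in unitmx) -> Ck k U f ->
  Ck k U (fun x => invmx (f x)).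
Proof.
move=> oU fU sf; apply: Ck_mx => // i j.
have D : Ck k U (fun x => (\det (f x))^-1 * cofactor (f x) j i).
  apply: Ck_mul => //.
    by apply: Ck_inv (Ck_det _ _) => // x /fU; rewrite unitmxE unitfE.
  apply: Ck_mul => //; first exact: Ck_cst.
  apply: Ck_det => //; apply: Ck_mx => // a b; under eq_fun do rewrite !mxE.
  exact: Ck_coord.
by apply: eq_Ck D => // x Ux; rewrite /invmx fU// !mxE.
Qed.

End Matrices.

Section MatrixDerivatives.
Context (V : normedModType R).

Lemma is_derive_mulmx m n p (f : V -> 'M[R]_(m, n)) (g : V -> 'M[R]_(n, p))
    x v df dg : is_derive x v f df -> is_derive x v g dg ->
  is_derive x v (fun y => f y *m g y) (df *m g x + f x *m dg).
Proof.
move=> [fD <-] [gD <-].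
have [fD' gD'] := (iffLR (derivable_mxP _ _ _) fD, iffLR (derivable_mxP _ _ _) gD).
have E i j : is_derive x v (fun y => (f y *m g y) i j)
    (('D_v f x *m g x + f x *m 'D_v g x) i j).
  pose h l (y : V) := f y i l * g y l j.
  have -> : (fun y => (f y *m g y) i j) = \sum_l h l.
    by apply/funext => y; rewrite mxE fct_sumE.
  apply: is_derive_eq; first by apply: is_derive_sum => l; apply/derivableP/derivableM.
  rewrite !mxE -big_split/=; apply: eq_bigr => l _.
  rewrite deriveM// !derive_mx// !mxE addrC; congr (_ + _).
  by rewrite mulrC.
have fgD : derivable (fun y => f y *m g y) x v.
  by apply/derivable_mxP => i j; exact: (@ex_derive _ _ _ _ _ _ _ (E i j)).
apply: DeriveDef => //; rewrite derive_mx//; apply/matrixP => i j.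
by rewrite mxE; exact: (@derive_val _ _ _ _ _ _ _ (E i j)).
Qed.

Lemma is_derive_trmx m n (f : V -> 'M[R]_(m, n)) x v df :
  is_derive x v f df -> is_derive x v (fun y => (f y)^T) df^T.
Proof.
move=> [fD <-]; have fD' := iffLR (derivable_mxP _ _ _) fD.
have tE i j : (fun y => (f y)^T i j) = (fun y => f y j i).
  by apply/funext => y; rewrite mxE.
have tD : derivable (fun y => (f y)^T) x v.
  by apply/derivable_mxP => i j; rewrite tE; exact: fD'.
apply: DeriveDef => //; rewrite !derive_mx//; apply/matrixP => i j.
by rewrite [LHS]mxE tE [RHS]mxE [RHS]mxE.
Qed.

End MatrixDerivatives.

End SmoothCalculus.

(** * Smoothness of matrix operations, of solutions of linear systems, and in time *)

Section SmoothMatrices.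
Context (R : realType).

Section SmoothOps.
Context (V : normedModType R) (U : set V).
Hypothesis oU : open U.

Lemma smooth_cst (W : normedModType R) (a : W) : smooth U (fun=> a).
Proof. by move=> k; exact: Ck_cst. Qed.

Lemma smooth_add (W : normedModType R) (f g : V -> W) : smooth U f -> smooth U g ->
  smooth U (fun x => f x + g x).
Proof. by move=> sf sg k; exact: Ck_add. Qed.

Lemma smooth_mulmx m n p (f : V -> 'M[R]_(m, n)) (g : V -> 'M[R]_(n, p)) :
  smooth U f -> smooth U g -> smooth U (fun x => f x *m g x).
Proof. by move=> sf sg k; exact: Ck_mulmx. Qed.

Lemma smooth_scale m n (f : V -> R) (g : V -> 'M[R]_(m, n)) :
  smooth U f -> smooth U g -> smooth U (fun x => f x *: g x).
Proof.
move=> sf sg k; apply: Ck_mx => // i j; under eq_fun do rewrite mxE.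
by apply: Ck_mul => //; exact: Ck_coord.
Qed.

Lemma smooth_opp m n (f : V -> 'M[R]_(m, n)) : smooth U f ->
  smooth U (fun x => - f x).
Proof.
move=> sf; under eq_fun do rewrite -scaleN1r.
by apply: smooth_scale => //; exact: smooth_cst.
Qed.

Lemma smooth_sub m n (f g : V -> 'M[R]_(m, n)) : smooth U f -> smooth U g ->
  smooth U (fun x => f x - g x).
Proof. by move=> sf sg; apply: smooth_add => //; exact: smooth_opp. Qed.

Lemma smooth_trmx m n (f : V -> 'M[R]_(m, n)) : smooth U f ->
  smooth U (fun x => (f x)^T).
Proof.
move=> sf k; apply: Ck_mx => // i j; under eq_fun do rewrite mxE.
exact: Ck_coord.
Qed.

Lemma smooth_row m n (f : V -> 'M[R]_(m, n)) i : smooth U f ->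
  smooth U (fun x => row i (f x)).
Proof.
move=> sf; under eq_fun do rewrite rowE.
by apply: smooth_mulmx => //; exact: smooth_cst.
Qed.

Lemma smooth_col_mx m1 m2 n (f : V -> 'M[R]_(m1, n)) (g : V -> 'M[R]_(m2, n)) :
  smooth U f -> smooth U g -> smooth U (fun x => col_mx (f x) (g x)).
Proof.
move=> sf sg k; apply: Ck_mx => // i j; case: (split_ordP i) => l ->.
  by under eq_fun do rewrite col_mxEu; exact: Ck_coord.
by under eq_fun do rewrite col_mxEd; exact: Ck_coord.
Qed.

Lemma smooth_jacobian n m (f : 'rV[R]_n -> 'rV[R]_m) (O : set 'rV[R]_n) :
  open O -> smooth O f -> smooth O (jacobian f).
Proof.
move=> oO sf k; apply: Ck_mx => // i j.
have D : Ck k O (fun u => ('D_(delta_mx 0 i) f u) 0 j : R).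
  by apply: Ck_coord => //; exact: smooth_derive.
apply: eq_Ck D => // u Ou; rewrite deriveEjacobian.
  by rewrite -rowE mxE.
exact: smooth_differentiable sf Ou.
Qed.

(** Turns an algebraic characterization of [X] into regularity: invertibility of [B] is an open
    condition, and where it holds [X] must be B^-1 C. The equation [m = n] is propositional because
    the system is later stacked from 2 and n - 2 rows. *)
Lemma smooth_solve m n k (B : V -> 'M[R]_(m, n)) (C : V -> 'M[R]_(m, k))
    (X : V -> 'M[R]_(n, k)) x0 : m = n -> smooth U B -> smooth U C ->
  (forall x, U x -> B x *m X x = C x) -> U x0 -> row_full (B x0) ->
  exists2 U', U' x0 & smooth U' X.
Proof.
move=> e; subst n => sB sC BX Ux0 B0.
have sdet x : U x -> {for x, continuous (fun y => \det (B y))}.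
  exact: (Ck_det oU (sB 0%N)).
pose U' := U `&` [set x | B x \in unitmx].
have oU' : open U'.
  rewrite openE => x [Ux /= Bx].
  have Ux' : nbhs x U by exact: open_nbhs_nbhs.
  apply: filterI => //.
  have : \forall y \near x, \det (B y) != 0.
    by apply: cvgr_neq0 (sdet x Ux) _; rewrite -unitfE -unitmxE.
  by apply: filterS => y /=; rewrite unitmxE unitfE.
exists U' => [|k']; first by split => //=; rewrite -row_full_unit.
have D : Ck k' U' (fun x => invmx (B x) *m C x).
  apply: Ck_mulmx => //; last by apply: sub_Ck (sC k') => x [].
  by apply: Ck_invmx => // [x []|] //; apply: sub_Ck (sB k') => x [].
by apply: eq_Ck D => // x [Ux Bx]; rewrite -BX// mulKmx.
Qed.

End SmoothOps.

Lemma open_rectangle (T T' : topologicalType) (A : set T) (B : set T') :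
  open A -> open B -> open (A `*` B).
Proof.
move=> oA oB; rewrite openE => -[x y] [/= Ax By].
by exists (A, B) => //; split; exact: open_nbhs_nbhs.
Qed.

Lemma open_normr_lt (d : R) : open [set t : R | `|t| < d].
Proof.
have -> : [set t : R | `|t| < d] = ball (0 : R) d.
  by apply/seteqP; split=> t; rewrite -ball_normE /= sub0r normrN.
exact: ball_open.
Qed.

Section TimeDependence.
Context (V W : normedModType R) (J : set R) (U : set V).
Hypotheses (oJ : open J) (oU : open U).

Lemma smooth_snd (f : V -> W) : smooth U f ->
  @smooth R (R^o * V)%type W (J `*` U) (f \o snd).
Proof.
move=> sf k; apply: (Ck_comp_affine (da := snd)) (sf k) => //.
- exact: open_rectangle.
- move=> x; apply: DiffDef.
    by apply: linear_differentiable => y; exact: cvg_snd.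
  by rewrite diff_lin// => y; exact: cvg_snd.
- by move=> x [].
Qed.

Lemma smooth_slice (f : R^o * V -> W) t : J t ->
  smooth (J `*` U) f -> smooth U (fun u => f (t, u)).
Proof.
move=> Jt sf k.
apply: (@Ck_comp_affine R V (R^o * V)%type W k U (J `*` U)
  (fun u => (t : R^o, u)) (fun u => (0 : R^o, u))) (sf k) => //.
Qed.

Lemma smooth_time :
  @smooth R (R^o * V)%type R (J `*` U) (fun tu => tu.1 : R).
Proof.
move=> k.
apply: (@Ck_comp_affine R (R^o * V)%type R^o R k _ setT fst fst id) => //.
- exact: open_rectangle.
- move=> x; apply: DiffDef.
    by apply: linear_differentiable => y; exact: cvg_fst.
  by rewrite diff_lin// => y; exact: cvg_fst.
case: k => [|k]; first by move=> x _.
split=> [x _|v]; first by [].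
have -> : 'D_v id = fun=> v :> R^o; last exact: Ck_cst.
by apply/funext => x; rewrite derive_id.
Qed.

End TimeDependence.

Lemma is_derive_scalel m n (a : 'M[R]_(m, n)) (t : R) :
  is_derive t (1 : R) (fun s : R => s *: a) a.
Proof.
have d : is_diff t (fun s : R => s *: a) (fun s : R => s *: a).
  exact: is_diff_scalel.
have dd := @ex_diff _ _ _ _ _ _ _ d.
apply: DeriveDef; first exact: diff_derivable.
by rewrite deriveE// (@diff_val _ _ _ _ _ _ _ d) scale1r.
Qed.

End SmoothMatrices.

(** * Linear algebra of the splitting *)

Section Splitting.
Context (F : fieldType) (n : nat) (P G : 'M[F]_n).
Hypotheses (skewP : P^T = - P) (PG1 : (P + G :=: 1%:M)%MS)
  (PG0 : (P :&: G)%MS = 0).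

Let Q := proj_mx P G.
Let Q' := proj_mx G P.
(** The leafwise symplectic form, extended by zero on [G] to a map TM -> T*M. *)
Let Theta := Q *m - (pinvmx P *m proj_mx (kermx G^T) (kermx P^T)).

Lemma eq_on_splitting m (A B : 'M[F]_(n, m)) :
  P *m A = P *m B -> G *m A = G *m B -> A = B.
Proof.
have /eqmxP/andP[_ /sub_addsmxP[[u v] /= def1]] := PG1 => PA GA.
by rewrite -[A]mul1mx -[B]mul1mx def1 !mulmxDl -!mulmxA PA GA.
Qed.

Lemma proj_split_id : P *m Q = P.
Proof. exact: proj_mx_id. Qed.

Lemma proj_split_0 : G *m Q = 0.
Proof. exact: proj_mx_0. Qed.

Lemma proj_split_compl : Q' = 1%:M - Q.
Proof.
have GP0 : (G :&: P)%MS = 0 by rewrite capmxC.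
apply: eq_on_splitting; rewrite mulmxBr mulmx1.
  by rewrite proj_split_id subrr proj_mx_0.
by rewrite proj_split_0 subr0 proj_mx_id.
Qed.

Lemma tr_proj_split : Q^T *m P = P.
Proof.
by apply: trmx_inj; rewrite trmx_mul trmxK skewP mulNmx proj_split_id.
Qed.

(** [pinvmx P] only picks some preimage under [P]; the ambiguity lies in the kernel of [P], which
    the projection [r] onto the annihilator of [G] discards. That projection is the transpose of
    [Q], since its image and kernel are the annihilators of [G] and of TF. *)
Lemma omega_split_P : P *m Theta = - Q^T.
Proof.
have cap0 : (kermx G^T :&: kermx P^T)%MS = 0.
  apply/eqP; rewrite -submx0; apply/rV_subP => a.
  rewrite sub_capmx !sub_kermx => /andP[/eqP aG /eqP aP].
  have -> : a = 0; last exact: sub0mx.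
  apply: trmx_inj; apply: eq_on_splitting.
    by rewrite trmx0 mulmx0; apply: trmx_inj; rewrite trmx_mul trmxK aP trmx0.
  by rewrite trmx0 mulmx0; apply: trmx_inj; rewrite trmx_mul trmxK aG trmx0.
rewrite /Theta mulmxA proj_split_id mulmxN mulmxA.
set r := proj_mx _ _.
have kP (A : 'M[F]_n) : A *m P = 0 -> A *m r = 0.
  by move=> AP; apply: proj_mx_0 => //; rewrite sub_kermx skewP mulmxN AP oppr0.
have QTr : Q^T *m r = Q^T.
  apply: proj_mx_id => //.
  by rewrite sub_kermx -trmx_mul proj_split_0 trmx0.
have -> : P *m pinvmx P *m r = r.
  apply/eqP; rewrite -subr_eq0 -{2}[r]mul1mx -mulmxBl; apply/eqP/kP.
  by rewrite mulmxBl mulmxKpV// mul1mx subrr.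
congr (- _); rewrite -[RHS]QTr; apply/eqP; rewrite -subr_eq0 -{1}[r]mul1mx -mulmxBl.
by apply/eqP/kP; rewrite mulmxBl mul1mx tr_proj_split subrr.
Qed.

Lemma omega_split_G : G *m Theta = 0.
Proof. by rewrite /Theta mulmxA proj_split_0 mul0mx. Qed.

Lemma omega_splitK : Theta *m P = - Q.
Proof.
apply: eq_on_splitting; rewrite mulmxA mulmxN.
  by rewrite omega_split_P mulNmx tr_proj_split proj_split_id.
by rewrite omega_split_G mul0mx proj_split_0 oppr0.
Qed.

End Splitting.

(** * Bivectors and alternating 3-tensors on a plane *)

Section Rank2.
Context (R : numFieldType) (n : nat).
Implicit Types (P V W : 'M[R]_n).

Lemma skew_diag m (A : 'M[R]_m) i : A^T = - A -> A i i = 0.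
Proof.
move=> /matrixP/(_ i i); rewrite !mxE => /eqP.
by rewrite -subr_eq0 opprK -mulr2n mulrn_eq0 => /eqP.
Qed.

Lemma skew_2x2 (A : 'M[R]_2) : A^T = - A ->
  A = A 0 1 *: (delta_mx 0 1 - delta_mx 1 0).
Proof.
move=> skA; apply/matrixP => i j; rewrite !mxE.
have A10 : A 1 0 = - A 0 1 by have /matrixP/(_ 0 1) := skA; rewrite !mxE.
have [e01 e10] : (0 == 1 :> 'I_2) = false /\ (1 == 0 :> 'I_2) = false by [].
have [] : (i = 0 \/ i = 1) /\ (j = 0 \/ j = 1).
  by split; [case: i|case: j] => -[|[|//]] ?; [left|right|left|right]; exact: val_inj.
by case=> -> [] ->; rewrite ?skew_diag// ?A10 ?eqxx ?e01 ?e10 /=; ring.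
Qed.

Lemma rank_base r P : \rank P = r ->
  exists B : 'M[R]_(r, n), (P <= B)%MS.
Proof. by move=> <-; exists (row_base P); rewrite eq_row_base. Qed.

(** Both are bivectors of the plane spanned by the two rows of [B], and the bivectors of a plane
    form a line. *)
Lemma skew_rank2 P V : P^T = - P -> V^T = - V -> \rank P = 2%N ->
  (V <= P)%MS -> exists f, V = f *: P.
Proof.
move=> skP skV rkP VP; have [B PB] := rank_base rkP.
have comp W : W^T = - W -> (W <= B)%MS ->
    exists c, W = c *: (B^T *m (delta_mx 0 1 - delta_mx 1 0) *m B).
  move=> skW WB; have [A WAB] : exists A : 'M[R]_(n, 2), W *m (A *m B) = W.
    by exists (pinvmx B); rewrite mulmxA mulmxKpV.
  pose w := A^T *m W *m A.
  have WE : W = B^T *m w *m B.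
    rewrite /w -!mulmxA WAB mulmxA -trmx_mul.
    by apply: trmx_inj; rewrite [RHS]trmx_mul trmxK skW mulNmx WAB.
  have skw : w^T = - w by rewrite /w !trmx_mul trmxK skW mulNmx mulmxN mulmxA.
  by exists (w 0 1); rewrite [LHS]WE scalemxAl scalemxAr -skew_2x2.
have [c PE] := comp P skP PB.
have [d VE] := comp V skV (submx_trans VP PB).
have c0 : c != 0.
  by apply: contra_eq_neq rkP => c0; rewrite PE c0 scale0r mxrank0.
by exists (d / c); rewrite VE PE scalerA divfK.
Qed.

(** A plane carries no nonzero trivector. Concretely, T(i, ., .) = f_i W; if f_i is not 0, then T(i,
    i, .) = 0 kills row i of [W], so that T(i, j, k) = T(j, k, i) = f_j W(k, i) = 0. *)
Lemma rank2_alternating W (T : 'I_n -> 'I_n -> 'I_n -> R) :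
  W^T = - W -> \rank W = 2%N ->
  (forall i j k, T i j k = - T j i k) -> (forall i j k, T i j k = T j k i) ->
  (forall i j, (\row_k T i j k <= W)%MS) -> forall i j k, T i j k = 0.
Proof.
move=> skW rkW anti cyc TW.
have fT i : exists f, forall j k, T i j k = f * W j k.
  have [||f fE] := @skew_rank2 W (\matrix_(j, k) T i j k) skW _ rkW.
  - by apply/matrixP => j k; rewrite !mxE cyc anti -cyc.
  - apply/row_subP => j; rewrite (_ : row j _ = \row_k T i j k)//.
    by apply/rowP => k; rewrite !mxE.
  by exists f => j k; have /matrixP/(_ j k) := fE; rewrite !mxE.
move=> i j k; have [f fE] := fT i.
rewrite fE; have [->|f0] := eqVneq f 0; first by rewrite mul0r.
have Wi l : W i l = 0.
  apply: (mulfI f0); rewrite mulr0 -fE.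
  by apply/eqP; have /eqP := anti i i l; rewrite -subr_eq0 opprK -mulr2n mulrn_eq0.
have [g gE] := fT j; rewrite -fE cyc gE.
have /matrixP/(_ k i) := skW; rewrite !mxE Wi => /eqP.
by rewrite eq_sym oppr_eq0 => /eqP ->; rewrite mulr0.
Qed.

(** [K v] stands for the derivative along [v], at a point, of the components of [W]; the last
    hypothesis is then involutivity, tested on the fields given by the rows of [W]. *)
Lemma jacobi_rank2 W (K : {linear 'rV[R]_n -> 'M[R]_n}) :
  W^T = - W -> \rank W = 2%N -> (forall v, (K v)^T = - K v) ->
  (forall i j, (row j (K (row i W)) - row i (K (row j W)) <= W)%MS) ->
  forall i j k, K (row i W) j k + K (row j W) k i + K (row k W) i j = 0.
Proof.
move=> skW rkW skK inv.
pose T i j k := K (row i W) j k + K (row j W) k i + K (row k W) i j.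
have KC v i j : K v i j = - K v j i.
  by have /matrixP/(_ j i) := skK v; rewrite !mxE.
apply: (@rank2_alternating W T) => //.
- by move=> i j k; rewrite /T (KC _ j k) (KC _ k i) (KC _ i j); ring.
- by move=> i j k; rewrite /T; ring.
(* T(i, j, .) is [X_i, X_j], for X_i the i-th row of W, plus an element of im W. *)
move=> i j; pose kappa := \row_l K (delta_mx 0 l) i j.
have -> : \row_k T i j k = row j (K (row i W)) - row i (K (row j W)) - kappa *m W.
  apply/rowP => k; rewrite !mxE /T (KC _ k i); congr (_ + _).
  rewrite (row_sum_delta (row k W)) linear_sum summxE -sumrN.
  apply: eq_bigr => l _; rewrite linearZ !mxE.
  by have /matrixP/(_ k l) := skW; rewrite !mxE => ->; ring.
by rewrite addmx_sub// eqmx_opp submxMl.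
Qed.

End Rank2.

Lemma trmx_conj (R : comPzRingType) m n (A : 'M[R]_(m, n)) (B : 'M[R]_m) :
  (A^T *m B *m A)^T = A^T *m B^T *m A.
Proof. by rewrite !trmx_mul trmxK mulmxA. Qed.

(** * Pointwise algebra of the lift *)

Section Lift.
Context (R : realFieldType) (n : nat) (P Z Theta Q : 'M[R]_n).
Hypotheses (skP : P^T = - P) (skZ : Z^T = - Z) (PTh : P *m Theta = - Q^T)
  (ThP : Theta *m P = - Q) (PQ : P *m Q = P)
  (good : (1%:M - Q)^T *m Z *m (1%:M - Q) = 0).

(** The tangential part is a bivector of the plane TF, whence f. The sign in the second identity is
    that of P Theta P = - P. *)
Lemma tangential_scale : \rank P = 2%N -> exists2 f,
  Q^T *m Z *m Q = f *: P &
  Q^T *m Z *m Q *m (Theta *m (Q^T *m Z *m Q)) = - f ^+ 2 *: P.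
Proof.
move=> rkP; have [||f ->] := @skew_rank2 R n P (Q^T *m Z *m Q) skP _ rkP.
- by rewrite trmx_conj skZ mulmxN mulNmx.
- have -> : Q = - Theta *m P by rewrite mulNmx ThP opprK.
  by rewrite [X in (X <= _)%MS]mulmxA submxMl.
exists f => //; rewrite -!scalemxAr -scalemxAl.
by rewrite ThP mulmxN PQ !scalerN scalerA scaleNr expr2.
Qed.

(* Z splits into its tangential part and the two mixed parts, which phi
   determines; the normal part vanishes. *)
Lemma lift_derivative (eta := Theta *m - Z *m (1%:M - Q)) :
  eta^T *m P + Q^T *m Z *m Q + P *m eta = Z.
Proof.
have Peta : P *m eta = Q^T *m Z *m (1%:M - Q).
  by rewrite /eta !mulmxA PTh mulNmx mulmxN opprK.
have etaP : eta^T *m P = (1%:M - Q)^T *m Z *m Q.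
  apply: trmx_inj; rewrite trmx_mul trmxK skP mulNmx Peta.
  by rewrite !trmx_mul trmxK skZ mulNmx mulmxN mulmxA.
rewrite etaP Peta; set S := 1%:M - Q.
have ZE : Z = (S^T + Q^T) *m Z *m (S + Q).
  by rewrite -[S^T + _]linearD subrK /= trmx1 mul1mx mulmx1.
have goodS : S^T *m Z *m S = 0 := good.
by rewrite [RHS]ZE mulmxDl mulmxDr !mulmxDl goodS add0r [RHS]addrC.
Qed.

End Lift.

(** * The bracket evaluated on covectors, and closedness of phi(Z) at a point *)

Section Contraction.
Context (R : realFieldType) (n : nat).
Implicit Types (K L : {linear 'rV[R]_n -> 'M[R]_n}) (P Z : 'M[R]_n)
  (a b c v : 'rV[R]_n).

Definition form K v b c : R := (b *m K v *m c^T) 0 0.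

Lemma formDv K v w b c : form K (v + w) b c = form K v b c + form K w b c.
Proof. by rewrite /form linearD mulmxDr mulmxDl mxE. Qed.

Lemma formNv K v b c : form K (- v) b c = - form K v b c.
Proof. by rewrite /form linearN mulmxN mulNmx mxE. Qed.

Lemma form_skew K v b c : (K v)^T = - K v -> form K v b c = - form K v c b.
Proof.
move=> skK; have -> : form K v b c = ((b *m K v *m c^T)^T) 0 0 by rewrite mxE.
by rewrite !trmx_mul trmxK skK mulNmx mulmxN mxE mulmxA.
Qed.

Lemma form_sum K P a b c : form K (a *m P) b c =
  \sum_i \sum_j \sum_k a 0 i * b 0 j * c 0 k * K (row i P) j k.
Proof.
rewrite /form (mulmx_sum_row a) linear_sum mulmx_sumr mulmx_suml summxE.
apply: eq_bigr => i _; rewrite linearZ /= -scalemxAr -scalemxAl mxE.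
rewrite mxE mulr_sumr exchange_big; apply: eq_bigr => k _ /=.
rewrite !mxE mulr_suml mulr_sumr; apply: eq_bigr => j _.
ring.
Qed.

Lemma sum_cyclic (T : 'I_n -> 'I_n -> 'I_n -> R) :
  \sum_i \sum_j \sum_k T i j k = \sum_i \sum_j \sum_k T j k i.
Proof.
rewrite [RHS]exchange_big; apply: eq_bigr => i _ /=.
by rewrite exchange_big.
Qed.

(** Trilinearity extends the identity from basis covectors to all covectors. [E1] and [E2] relabel
    the two shifted terms so that all three carry the factor a_i b_j c_k. *)
Lemma form_cyclic K L P Z :
  (forall i j k, K (row i P) j k + L (row i Z) j k
    + (K (row j P) k i + L (row j Z) k i)
    + (K (row k P) i j + L (row k Z) i j) = 0) ->
  forall a b c, form K (a *m P) b c + form L (a *m Z) b c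
    + (form K (b *m P) c a + form L (b *m Z) c a)
    + (form K (c *m P) a b + form L (c *m Z) a b) = 0.
Proof.
move=> cyc0 a b c; pose T i j k := K (row i P) j k + L (row i Z) j k.
have E x y z : form K (x *m P) y z + form L (x *m Z) y z =
    \sum_i \sum_j \sum_k x 0 i * y 0 j * z 0 k * T i j k.
  rewrite !form_sum -big_split; apply: eq_bigr => i _ /=.
  rewrite -big_split; apply: eq_bigr => j _ /=; rewrite -big_split.
  by apply: eq_bigr => k _ /=; rewrite -mulrDr.
have E1 x y z : form K (x *m P) y z + form L (x *m Z) y z =
    \sum_i \sum_j \sum_k x 0 j * y 0 k * z 0 i * T j k i.
  by rewrite E; exact: (sum_cyclic (fun i j k => x 0 i * y 0 j * z 0 k * T i j k)).
have E2 x y z : form K (x *m P) y z + form L (x *m Z) y z =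
    \sum_i \sum_j \sum_k x 0 k * y 0 i * z 0 j * T k i j.
  by rewrite E1; exact: (sum_cyclic (fun i j k => x 0 j * y 0 k * z 0 i * T j k i)).
rewrite E E1 E2.
rewrite -!big_split big1// => i _ /=; rewrite -!big_split big1// => j _ /=.
rewrite -!big_split big1// => k _ /=.
have T0 : T i j k + T j k i + T k i j = 0 by exact: cyc0.
by rewrite -[RHS](mulr0 (a 0 i * b 0 j * c 0 k)) -T0; ring.
Qed.

Lemma form_jacobi K P :
  (forall i j k, K (row i P) j k + K (row i P) j k
    + (K (row j P) k i + K (row j P) k i)
    + (K (row k P) i j + K (row k P) i j) = 0) ->
  forall a b c, form K (a *m P) b c + form K (b *m P) c a + form K (c *m P) a b = 0.
Proof.
move=> cyc0 a b c; have := form_cyclic cyc0 a b c.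
by set x := form _ _ _ _; set y := form _ _ _ _; set z := form _ _ _ _; lra.
Qed.

(* This is d_nabla phi(Z) (X, Y) paired with a conormal covector bt.  Here L
   and K are the derivatives at a point of the components of P and Z, X = aP,
   Y = bP, xe = phi(Z)(X), ye = phi(Z)(Y), and db, da, sb, sa, da', db' are
   values of the derivatives of b, a, gb, ga.  The expression is
   [P, Z](a, b, bt), which is 0, up to the Jacobi identity for P at (a, b, c),
   (a, gb, bt) and (b, ga, bt), where cP = bt Z. *)
Lemma phi_closed_form (P Z Theta Q : 'M[R]_n) (K L : {linear 'rV[R]_n -> 'M[R]_n})
    (a b ga gb da db db' da' sa sb : 'rV[R]_n) (xe ye : 'rV[R]_n) (bt : 'rV[R]_n) :
  P^T = - P -> Z^T = - Z -> P *m Theta = - Q^T -> Theta *m P = - Q ->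
  P *m Q = P -> Theta *m Q^T = Theta -> (1%:M - Q)^T *m Z *m (1%:M - Q) = 0 ->
  (forall v, (K v)^T = - K v) -> (forall v, (L v)^T = - L v) ->
  (forall i j k, L (row i P) j k + L (row i P) j k
    + (L (row j P) k i + L (row j P) k i)
    + (L (row k P) i j + L (row k P) i j) = 0) ->
  (forall i j k, K (row i P) j k + L (row i Z) j k
    + (K (row j P) k i + L (row j Z) k i)
    + (K (row k P) i j + L (row k Z) i j) = 0) ->
  xe = a *m Z - ga *m P -> ye = b *m Z - gb *m P -> P *m bt^T = 0 ->
  ((db *m Z + b *m K (a *m P) - (sb *m P + gb *m L (a *m P))
     - (da' *m P + a *m L ye))
   - (da *m Z + a *m K (b *m P) - (sa *m P + ga *m L (b *m P))
     - (db' *m P + b *m L xe))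
   - ((db *m P + b *m L (a *m P)) - (da *m P + a *m L (b *m P)))
       *m (Theta *m - Z *m (1%:M - Q))) *m bt^T = 0.
Proof.
move=> skP skZ PTh ThP PQ ThQ good skK skL jacP jacZ xeE yeE Pb.
have QTP : Q^T *m P = P by apply: trmx_inj; rewrite trmx_mul trmxK skP mulNmx PQ.
have Qb : Q *m bt^T = 0 by rewrite -[Q]opprK -ThP mulNmx -mulmxA Pb mulmx0 oppr0.
have Q'b : (1%:M - Q) *m bt^T = bt^T by rewrite mulmxBl mul1mx Qb subr0.
(* As [Z] is good and [bt] is conormal, bt Z is tangent to the leaf; [c] is the covector vanishing
   on G that [P] maps to it. *)
pose c := - (bt *m Z *m Theta).
have cP : c *m P = bt *m Z.
  rewrite /c mulNmx -[_ *m _ *m P]mulmxA ThP mulmxN opprK.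
  have : bt *m Z *m (1%:M - Q) = 0.
    by rewrite -[bt]trmxK -Q'b trmx_mul -2!mulmxA (mulmxA _ Z) good mulmx0.
  by rewrite mulmxBr mulmx1 => /eqP; rewrite subr_eq0 => /eqP <-.
have cQ : c *m Q^T = c by rewrite /c mulNmx -!mulmxA ThQ.
have Zb : Z *m bt^T = P *m c^T.
  by apply: trmx_inj; rewrite trmx_mul trmxK skZ mulmxN -cP trmx_mul trmxK skP mulmxN.
(* Pairing phi(Z)(v) with [bt] amounts to pairing v with [c], after which phi(Z) can be abstracted
   away. *)
have ThZb : Theta *m - Z *m (1%:M - Q) *m bt^T = c^T.
  rewrite -mulmxA Q'b mulmxN mulNmx -mulmxA Zb mulmxA ThP mulNmx opprK.
  by rewrite -{2}cQ trmx_mul trmxK.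
move: (Theta *m - Z *m (1%:M - Q)) ThZb => eta etab.
have DE (A B : 'M[R]_1) : (A + B) 0 0 = A 0 0 + B 0 0 by rewrite mxE.
have NE (A : 'M[R]_1) : (- A) 0 0 = - A 0 0 by rewrite mxE.
have fE (N : {linear 'rV[R]_n -> 'M[R]_n}) v (x y : 'rV[R]_n) :
    (x *m (N v *m y^T)) 0 0 = form N v x y by rewrite /form mulmxA.
apply/matrixP => i j; rewrite !ord1 {i j} [RHS]mxE.
(* All derivatives of covector fields drop out: those multiplied by [P] vanish on [bt], while db Z
   bt^T = db P c^T cancels against the contribution of [X, Y], and likewise for da. What remains is
   linear in values of [form]. *)
rewrite !(mulmxDl, mulNmx) -!mulmxA Pb etab Zb !mulmx0 !(DE, NE, fE) xeE yeE.
have OE : (0 : 'M[R]_1) 0 0 = 0 by rewrite mxE.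
rewrite !(formDv, formNv, OE).
have btP : bt *m P = 0.
  by apply: trmx_inj; rewrite trmx_mul skP mulNmx Pb oppr0 trmx0.
have f0 N x y : form N 0 x y = 0 by rewrite /form linear0 mulmx0 mul0mx mxE.
have := form_cyclic jacZ a b bt.
rewrite btP -cP !f0 (form_skew bt a (skK (b *m P))) (form_skew bt a (skL (b *m Z))).
have := form_jacobi jacP a b c; rewrite (form_skew c a (skL (b *m P))).
have := form_jacobi jacP a gb bt; rewrite btP f0 (form_skew bt a (skL (gb *m P))).
have := form_jacobi jacP b ga bt; rewrite btP f0 (form_skew bt b (skL (ga *m P))).
lra.
Qed.

End Contraction.

(** * Charts *)

Lemma eq_mulmx_rV (R : pzSemiRingType) m n (A B : 'M[R]_(m, n)) :
  (forall v : 'rV_m, v *m A = v *m B) -> A = B.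
Proof. by move=> AB; apply/row_matrixP => i; rewrite !rowE. Qed.

Section Jacobian.
Context (R : realType).

Lemma near_eq_jacobian m n (f g : 'rV[R]_m -> 'rV[R]_n) u :
  (\near u, f u = g u) -> differentiable f u -> jacobian f u = jacobian g u.
Proof.
move=> fg df; have dg := near_eq_differentiable fg df.
apply: eq_mulmx_rV => v.
have Df := deriveEjacobian v df.
have Dg := deriveEjacobian v dg.
have E : 'D_v f u = 'D_v g u by exact: near_eq_derive.
rewrite Df Dg in E.
exact: E.
Qed.

Lemma jacobian_comp l m n (f : 'rV[R]_l -> 'rV[R]_m) (g : 'rV[R]_m -> 'rV[R]_n) u :
  differentiable f u -> differentiable g (f u) ->
  jacobian (g \o f) u = jacobian f u *m jacobian g (f u).
Proof.
move=> df dg; apply: eq_mulmx_rV => v.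
by rewrite mulmxA /jacobian mul_rV_lin1 mul_rV_lin1 mul_rV_lin1 diff_comp.
Qed.

Lemma jacobian_id n (u : 'rV[R]_n) : jacobian id u = 1%:M.
Proof.
by apply: eq_mulmx_rV => v; rewrite /jacobian mul_rV_lin1 diff_val mulmx1.
Qed.

End Jacobian.

Section Charts.
Context (R : realType) (n : nat) (M : manifold R n).
Implicit Types (c d : chart M) (p q : M) (U : set M).

Lemma dom_chart_at p : dom (chart_at p) p.
Proof. by rewrite /chart_at; case: cid. Qed.

Lemma chart_imageP c U u : (cmap c @` (dom c `&` U)) u ->
  [/\ dom c (cinv c u), U (cinv c u) & cmap c (cinv c u) = u].
Proof. by case=> p [cp Up] <-; rewrite cmapK. Qed.

Lemma codom_cmap c U p : dom c p -> U p -> (cmap c @` (dom c `&` U)) (cmap c p).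
Proof. by exists p. Qed.

Lemma open_codomI c U : open U -> open (cmap c @` (dom c `&` U)).
Proof.
move=> oU; rewrite openE => u uU; have [cu Uu cuK] := chart_imageP uU.
have cu' : (cmap c @` dom c) u by exists (cinv c u).
have n1 : nbhs u (cmap c @` dom c).
  by apply: open_nbhs_nbhs; split=> //; exact: open_codom.
have n2 : nbhs u (cinv c @^-1` U).
  by apply: cinv_continuous => //; exact: open_nbhs_nbhs.
apply: filterS2 n1 n2 => _ [q cq <-] /=; rewrite cmapK// => Uq.
by exists q.
Qed.

Lemma near_codom c U p : open U -> dom c p -> U p ->
  \forall u \near cmap c p, (cmap c @` (dom c `&` U)) u.
Proof.
move=> oU cp Up; apply: open_nbhs_nbhs.
by split; [exact: open_codomI|exact: codom_cmap].
Qed.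

Definition trans_jac c d p := jacobian (cmap d \o cinv c) (cmap c p).

Lemma transition_differentiable c d p : dom c p -> dom d p ->
  differentiable (cmap d \o cinv c) (cmap c p).
Proof.
move=> cp dp; apply: smooth_differentiable (transition_smooth c d) _.
exact: codom_cmap.
Qed.

Lemma trans_jac_comp a c d p : dom a p -> dom c p -> dom d p ->
  trans_jac a d p = trans_jac a c p *m trans_jac c d p.
Proof.
move=> ap cp dp; rewrite /trans_jac.
have cE : (cmap c \o cinv a) (cmap a p) = cmap c p by rewrite /= cmapK.
have := @jacobian_comp R n n n _ (cmap d \o cinv c) _ (transition_differentiable ap cp).
rewrite cE => /(_ (transition_differentiable cp dp)) <-.
apply: near_eq_jacobian; last exact: transition_differentiable.
have := near_codom (open_dom c) ap cp; apply: filterS => u /chart_imageP[_ cu _].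
by rewrite /= cmapK.
Qed.

Lemma trans_jac_id c p : dom c p -> trans_jac c c p = 1%:M.
Proof.
move=> cp; rewrite -[RHS](jacobian_id (cmap c p)); apply: near_eq_jacobian.
  by have := near_codom openT cp I; apply: filterS => u /chart_imageP[_ _].
exact: transition_differentiable.
Qed.

Lemma jac_trans c d p : dom c p -> dom d p -> jac d p = jac c p *m trans_jac c d p.
Proof. by move=> cp dp; apply: trans_jac_comp => //; exact: dom_chart_at. Qed.

Lemma jac_chart_at p : jac (chart_at p) p = 1%:M.
Proof. exact/trans_jac_id/dom_chart_at. Qed.

Lemma jac_unit c p : dom c p -> jac c p \in unitmx.
Proof.
move=> cp; have ap := dom_chart_at p.
have H : jac c p *m trans_jac c (chart_at p) p = 1%:M.
  by rewrite -jac_trans// jac_chart_at.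
by have [uc _] := mulmx1_unit H; exact uc.
Qed.

Lemma smooth_trans_jac c d :
  smooth (cmap c @` (dom c `&` dom d)) (fun u => trans_jac c d (cinv c u)).
Proof.
have oO := @open_codomI c _ (open_dom d).
have S := smooth_jacobian oO (@transition_smooth R n M c d).
refine (eq_smooth oO _ S) => u /chart_imageP[_ _ cuK].
by rewrite /trans_jac cuK.
Qed.

(* A covariant 2-tensor T, acting by X |-> X *m T from TM to T*M. *)
Definition cov_in c p (T : 'M[R]_n) : 'M[R]_n :=
  invmx (jac c p) *m T *m (invmx (jac c p))^T.

Section Components.
Context (c : chart M) (p : M).
Hypothesis cp : dom c p.
Let u := jac_unit cp.

Lemma vec_in_end m (A : 'M[R]_(m, n)) E :
  vec_in c p (A *m E) = vec_in c p A *m end_in c p E.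
Proof. by rewrite /vec_in /end_in !mulmxA mulmxK. Qed.

Lemma vec_in_cov m (A : 'M[R]_(m, n)) T :
  vec_in c p A *m cov_in c p T = A *m T *m (invmx (jac c p))^T.
Proof. by rewrite /vec_in /cov_in !mulmxA mulmxK. Qed.

Lemma biv_in_end W E : biv_in c p (W *m E) = biv_in c p W *m end_in c p E.
Proof. by rewrite /biv_in /end_in !mulmxA mulmxK. Qed.

Lemma biv_in_cov W T :
  biv_in c p W *m cov_in c p T = (jac c p)^T *m (W *m T) *m (invmx (jac c p))^T.
Proof. by rewrite /biv_in /cov_in !mulmxA mulmxK. Qed.

Lemma end_in_cov_biv T W : end_in c p (T *m W) = cov_in c p T *m biv_in c p W.
Proof.
rewrite /end_in /cov_in /biv_in !mulmxA -[_ *m _^T *m _^T]mulmxA -trmx_mul.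
by rewrite mulmxV// trmx1 mulmx1.
Qed.

Lemma end_inD E E' : end_in c p (E + E') = end_in c p E + end_in c p E'.
Proof. by rewrite /end_in mulmxDr mulmxDl. Qed.

Lemma end_inN E : end_in c p (- E) = - end_in c p E.
Proof. by rewrite /end_in mulmxN mulNmx. Qed.

Lemma end_inM E E' : end_in c p (E *m E') = end_in c p E *m end_in c p E'.
Proof. by rewrite /end_in !mulmxA mulmxK. Qed.

Lemma end_in1 : end_in c p 1%:M = 1%:M.
Proof. by rewrite /end_in mulmx1 mulVmx. Qed.

Lemma biv_in_conj E W :
  biv_in c p (E^T *m W *m E) = (end_in c p E)^T *m biv_in c p W *m end_in c p E.
Proof.
rewrite biv_in_end; congr (_ *m _).
rewrite /biv_in !mulmxA -!trmx_mul; congr (_^T *m _ *m _).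
by rewrite /end_in !mulmxA mulmxV// mul1mx.
Qed.

End Components.

End Charts.

Lemma rank_select (F : fieldType) r m n (A : 'M[F]_(m, n)) : \rank A = r ->
  exists S : 'M[F]_(r, m), (A <= S *m A)%MS.
Proof.
move=> <-; exists (row_base A *m pinvmx A).
by rewrite mulmxKpV eq_row_base.
Qed.

(** * Smoothness of the projection and of the extended leafwise form *)

Section SmoothSplitting.
Context (R : realType) (n : nat) (M : manifold R n) (P G : M -> 'M[R]_n).
Hypotheses (bivP : bivector_field P) (rkP : forall p, \rank (P p) = 2%N)
  (smoothG : smooth_distribution (n - 2) G) (complG : complementary P G).

Let skewP p : (P p)^T = - P p. Proof. by case: bivP. Qed.
Let PG1 p : (P p + G p :=: 1%:M)%MS. Proof. by case: (complG p). Qed.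
Let PG0 p : (P p :&: G p)%MS = 0. Proof. by case: (complG p). Qed.

Definition split_proj p := proj_mx (P p) (G p).
Definition split_omega p := split_proj p *m omega_flat P G p.

Local Notation Q := split_proj.
Local Notation Theta := split_omega.

Lemma split_PQ p : P p *m Q p = P p.
Proof. exact: proj_split_id. Qed.

Lemma split_GQ p : G p *m Q p = 0.
Proof. exact: proj_split_0. Qed.

Lemma split_PTheta p : P p *m Theta p = - (Q p)^T.
Proof. exact: (omega_split_P (skewP p) (PG1 p) (PG0 p)). Qed.

Lemma split_GTheta p : G p *m Theta p = 0.
Proof. exact: (omega_split_G (PG0 p)). Qed.

Lemma split_ThetaP p : Theta p *m P p = - Q p.
Proof. exact: (omega_splitK (skewP p) (PG1 p) (PG0 p)). Qed.

Lemma split_QQ p : Q p *m Q p = Q p.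
Proof.
apply: (eq_on_splitting (PG1 p)); rewrite mulmxA ?split_PQ//.
by rewrite split_GQ mul0mx.
Qed.

Lemma split_ThetaQ p : Theta p *m (Q p)^T = Theta p.
Proof.
apply: (eq_on_splitting (PG1 p)); rewrite mulmxA.
  by rewrite split_PTheta mulNmx -trmx_mul split_QQ.
by rewrite split_GTheta mul0mx.
Qed.

Opaque split_proj split_omega.

(* Near p0, two constant combinations of the rows of P together with a frame of
   G form a frame of TM, in which X solves a linear system. *)
Lemma smooth_of_splitting c (X C : 'rV[R]_n -> 'M[R]_n) :
  smooth (cmap c @` (dom c `&` setT)) C ->
  (forall q, dom c q -> biv_in c q (P q) *m X (cmap c q) = C (cmap c q)) ->
  (forall q, dom c q -> vec_in c q (G q) *m X (cmap c q) = 0) ->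
  smooth (cmap c @` (dom c `&` setT)) X.
Proof.
move=> sC PX GX; apply: smooth_local => _ [p0 [cp0 _] <-].
have [U [Y [oU Up0 sY YE]]] := smoothG p0.
have uJ := jac_unit cp0.
have rkc : \rank (biv_in c p0 (P p0)) = 2%N.
  rewrite /biv_in mxrankMfree ?row_free_unit// -mxrank_tr trmx_mul trmxK.
  by rewrite mxrankMfree ?row_free_unit// mxrank_tr.
have [S PS] := rank_select rkc.
have oO := @open_codomI R n M c U oU.
have Ou0 : (cmap c @` (dom c `&` U)) (cmap c p0) by exact: codom_cmap.
have sO : cmap c @` (dom c `&` U) `<=` cmap c @` (dom c `&` setT).
  by move=> _ [q [cq _] <-]; exists q.
pose B u := col_mx (S *m rep (@biv_in R n M) c P u) (rep (@vec_in R n M (n - 2)) c Y u).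
pose D u := col_mx (S *m C u) (0 : 'M[R]_(n - 2, n)).
(* Subtraction truncates, so this needs 2 <= n, which the rank of [P p0] provides. *)
have n2 : (2 + (n - 2) = n)%N by rewrite subnKC// -(rkP p0) rank_leq_row.
apply: (smooth_solve oO (B := B) (C := D)) => //.
- apply: smooth_col_mx => //.
  apply: smooth_mulmx => //; first exact: smooth_cst.
  by apply: sub_smooth sO _; case: bivP.
- apply: smooth_col_mx => //; last exact: smooth_cst.
  by apply: smooth_mulmx => //; [exact: smooth_cst|exact: sub_smooth sO sC].
- move=> _ [q [cq Uq] <-]; rewrite /B /D mul_col_mx /rep cmapK// -mulmxA PX//.
  have [_ YG] := YE _ Uq.
  have /submxP[w ->] : (Y q <= G q)%MS by rewrite YG.
  by rewrite /vec_in -!mulmxA (mulmxA (G q)) GX// mulmx0.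
(* Full rank at [p0]: since P and G span the tangent space, the rows of the system span those of the
   invertible [J]. *)
rewrite -sub1mx /B /rep cmapK//; set J := jac c p0 in uJ *.
have [_ YG] := YE _ Up0.
have JB : (J <= col_mx (S *m biv_in c p0 (P p0)) (vec_in c p0 (Y p0)))%MS.
  have /eqmxP/andP[_ /sub_addsmxP[[u v] /= def1]] := PG1 p0.
  rewrite -[J]mul1mx def1 mulmxDl -addsmxE addmx_sub_adds//.
    apply: submx_trans PS; rewrite /biv_in -/J.
    have -> : u *m P p0 *m J = u *m invmx J^T *m (J^T *m P p0 *m J).
      by rewrite !mulmxA mulmxKV// unitmx_tr.
    exact: submxMl.
  have /submxP[w ->] : (G p0 <= Y p0)%MS by rewrite YG.
  by rewrite -!mulmxA mulmxA submxMl.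
apply: submx_trans JB.
by rewrite -(mulVmx uJ) submxMl.
Qed.

(** P Q = P and G Q = 0 prescribe [Q] on a spanning family by smooth data. The form comes next,
    because its own equations have [Q] on the right-hand side. *)
Lemma smooth_split_proj : smooth_field (@end_in R n M) setT Q.
Proof.
move=> c; apply: (smooth_of_splitting (C := rep (@biv_in R n M) c P)).
- by case: bivP.
- by move=> q cq; rewrite /rep cmapK// -biv_in_end// split_PQ.
- by move=> q cq; rewrite /rep cmapK// -vec_in_end// split_GQ /vec_in mul0mx.
Qed.

Lemma smooth_split_omega : smooth_field (@cov_in R n M) setT Theta.
Proof.
move=> c; have sQ := smooth_split_proj c.
have oc := @open_codomI R n M c setT openT.
apply: (smooth_of_splitting (C := fun u => - (rep (@end_in R n M) c Q u)^T)).
- by apply: smooth_opp => //; exact: smooth_trmx.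
- move=> q cq; rewrite /rep cmapK//; have uJ := jac_unit cq.
  rewrite biv_in_cov// split_PTheta mulmxN mulNmx /end_in; move: (Q q) => Qq.
  by rewrite !trmx_mul mulmxA.
- by move=> q cq; rewrite /rep cmapK// vec_in_cov// split_GTheta mul0mx.
Qed.

End SmoothSplitting.

(** * Involutivity and the Jacobi identity *)

Lemma derive_skew (R : realType) (V : normedModType R) n (f : V -> 'M[R]_n) x v :
  derivable f x v -> (\near x, (f x)^T = - f x) -> ('D_v f x)^T = - 'D_v f x.
Proof.
move=> fD skf; have fT := is_derive_trmx (derivableP fD).
by rewrite -(@derive_val _ _ _ _ _ _ _ fT) (near_eq_derive v skf) deriveN.
Qed.

Lemma derive_row (R : realType) (V : normedModType R) m n
    (f : V -> 'M[R]_(m, n)) i x v :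
  derivable f x v -> 'D_v (fun y => row i (f y)) x = row i ('D_v f x).
Proof.
move=> fD; under eq_fun do rewrite rowE.
have D := is_derive_mulmx (is_derive_cst (delta_mx 0 i : 'M[R]_(1, m)) x v)
  (derivableP fD).
by rewrite (@derive_val _ _ _ _ _ _ _ D) mul0mx add0r -rowE.
Qed.

Section LocalFields.
Context (R : realType) (n : nat) (M : manifold R n).
Implicit Types (c : chart M) (p q : M).

Lemma near_codomT c p : dom c p ->
  \forall u \near cmap c p, (cmap c @` (dom c `&` setT)) u.
Proof. by move=> cp; exact: near_codom openT cp I. Qed.

Lemma rep_differentiable (W1 : Type) (W2 : normedModType R)
    (comp : chart M -> M -> W1 -> W2) (S : M -> W1) c p :
  smooth_field comp setT S -> dom c p -> differentiable (rep comp c S) (cmap c p).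
Proof. by move=> sS cp; apply: smooth_differentiable (sS c) _; exact: codom_cmap. Qed.

Lemma rep_cmap (W1 : Type) (W2 : Type)
    (comp : chart M -> M -> W1 -> W2) (S : M -> W1) c p : dom c p ->
  rep comp c S (cmap c p) = comp c p (S p).
Proof. by move=> cp; rewrite /rep cmapK. Qed.

Lemma biv_in_skew c p W : W^T = - W -> (biv_in c p W)^T = - biv_in c p W.
Proof.
by move=> skW; rewrite /biv_in !trmx_mul trmxK skW mulNmx mulmxN mulmxA.
Qed.

Lemma near_rep_skew c p W : (forall p, (W p)^T = - W p) -> dom c p ->
  \forall u \near cmap c p,
    (rep (@biv_in R n M) c W u)^T = - rep (@biv_in R n M) c W u.
Proof.
by move=> skW cp; near=> u; exact/biv_in_skew/skW.
Unshelve. all: by end_near. Qed.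

Lemma biv_in_chart_at p W : biv_in (chart_at p) p W = W.
Proof. by rewrite /biv_in jac_chart_at trmx1 mul1mx mulmx1. Qed.

(** Smoothness makes the directional derivatives linear in the direction, as the pointwise lemmas
    require of [K] and [L]. *)
Lemma schoutenE (W Z : M -> 'M[R]_n) p i j k :
  let K := 'd (rep (@biv_in R n M) (chart_at p) Z) (cmap (chart_at p) p) in
  let L := 'd (rep (@biv_in R n M) (chart_at p) W) (cmap (chart_at p) p) in
  smooth_field (@biv_in R n M) setT W -> smooth_field (@biv_in R n M) setT Z ->
  schouten W Z p i j k =
    K (row i (W p)) j k + L (row i (Z p)) j k
    + (K (row j (W p)) k i + L (row j (Z p)) k i)
    + (K (row k (W p)) i j + L (row k (Z p)) i j).
Proof.
move=> K L sW sZ; rewrite /schouten.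
have cp := dom_chart_at p.
by rewrite !deriveE//; exact: rep_differentiable.
Qed.

Lemma involutive_schouten (D W : M -> 'M[R]_n) :
  bivector_field W -> (forall p, \rank (W p) = 2%N) ->
  (forall p, (D p :=: W p)%MS) -> Defs.involutive D ->
  forall p i j k, schouten W W p i j k = 0.
Proof.
move=> [skW sW] rkW DW inv p i j k.
have cp := dom_chart_at p; set c := chart_at p in cp.
rewrite schoutenE// -/c; pose f := rep (@biv_in R n M) c W.
have df : differentiable f (cmap c p) by exact: rep_differentiable.
rewrite -/f; set K := 'd f (cmap c p).
have KE v : 'D_v f (cmap c p) = K v by exact: deriveE.
(* The field W^#(dx^l) for the l-th coordinate of [c]: row l of the transposed Jacobian is dx^l in
   the preferred basis at [q]. It is smooth on [dom c] only, where its components in [c] are row l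
   of those of [W]. *)
pose X l q := row l ((jac c q)^T *m W q).
have sX l : smooth_field (@vec_in R n M 1) (dom c) (X l).
  move=> d; have oO := @open_codomI R n M d _ (open_dom c).
  have S : smooth (cmap d @` (dom d `&` dom c))
      (fun u => row l ((trans_jac d c (cinv d u))^T *m rep (@biv_in R n M) d W u)).
    apply: smooth_row => //; apply: smooth_mulmx => //.
      by apply: smooth_trmx => //; exact: smooth_trans_jac.
    by apply: sub_smooth (sW d) => _ [q [dq _] <-]; exists q.
  apply: eq_smooth S => // u /chart_imageP[du cu _]; rewrite /rep /vec_in /X -row_mul.
  by rewrite (jac_trans du cu) trmx_mul /biv_in !mulmxA.
have XD l q : dom c q -> (X l q <= D q)%MS.
  by move=> _; rewrite DW /X row_mul submxMl.
have Xp l : X l p = row l (W p) by rewrite /X jac_chart_at trmx1 mul1mx.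
have DX l v : 'D_v (rep (@vec_in R n M 1) c (X l)) (cmap c p) = row l (K v).
  rewrite -KE -derive_row; last exact: diff_derivable.
  apply: near_eq_derive; have := near_codomT cp.
  apply: filterS => u /chart_imageP[cu _ _].
  by rewrite /rep /vec_in /X -row_mul.
(* With both arguments equal to [W], every term of [schouten] occurs twice. *)
have double (x y z : R) : x + y + z = 0 -> x + x + (y + y) + (z + z) = 0.
  lra.
apply: double; apply: (@jacobi_rank2 R n (W p) K (skW p) (rkW p)).
- move=> v; rewrite -KE; apply: derive_skew; first exact: diff_derivable.
  exact: near_rep_skew.
- move=> a b; have := inv _ _ _ (open_dom c) (sX a) (sX b) (XD a) (XD b) p cp.
  by rewrite DW /lie -/c !DX !Xp.
Qed.

End LocalFields.

(** * The infinitesimal deformation phi(Z) *)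

Lemma submx_tested (F : fieldType) m n (v : 'rV[F]_n) (P : 'M[F]_(m, n)) :
  (forall w : 'rV_n, P *m w^T = 0 -> v *m w^T = 0) -> (v <= P)%MS.
Proof.
move=> vP; rewrite submxE; apply/eqP/trmx_inj/row_matrixP => j.
rewrite -tr_col trmx0 row0; apply: trmx_inj; rewrite trmxK trmx0.
rewrite colE -mulmxA -colE -[col _ _]trmxK; apply: vP.
by rewrite trmxK colE mulmxA mulmx_coker mul0mx.
Qed.

(** The rows of (1 - Q)^T are conormal, so goodness says that the normal-normal block of [Z]
    vanishes. *)
Lemma good_split (F : fieldType) n (P G Z : 'M[F]_n) :
  (P :&: G)%MS = 0 ->
  (forall a b : 'rV_n, (a <= kermx P^T)%MS -> (b <= kermx P^T)%MS ->
     a *m Z *m b^T = 0) ->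
  (1%:M - proj_mx P G)^T *m Z *m (1%:M - proj_mx P G) = 0.
Proof.
move=> PG0 good; set S := 1%:M - _.
have kS (v : 'rV_n) : (v *m S^T <= kermx P^T)%MS.
  rewrite sub_kermx -mulmxA -trmx_mul /S mulmxBr mulmx1 proj_split_id//.
  by rewrite subrr trmx0 mulmx0.
apply: eq_mulmx_rV => v; apply/trmx_inj/eq_mulmx_rV => w; apply: trmx_inj.
rewrite mulmx0 trmx0 mulmx0 trmx0 trmx_mul trmxK.
by have := good _ _ (kS v) (kS w); rewrite trmx_mul trmxK !mulmxA.
Qed.

Section Phi.
Context (R : realType) (n : nat) (M : manifold R n) (P G Z : M -> 'M[R]_n).
Hypotheses (poissonP : regular_poisson 2 P)
  (smoothG : smooth_distribution (n - 2) G) (complG : complementary P G)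
  (infZ : poisson_inf_def P Z).

Let bivP : bivector_field P. Proof. by case: poissonP. Qed.
Let rkP p : \rank (P p) = 2%N. Proof. by case: poissonP. Qed.
Let skewP p : (P p)^T = - P p. Proof. by case: bivP. Qed.
Let sP : smooth_field (@biv_in R n M) setT P. Proof. by case: bivP. Qed.
Let skewZ p : (Z p)^T = - Z p. Proof. by case: infZ => -[]. Qed.
Let sZ : smooth_field (@biv_in R n M) setT Z. Proof. by case: infZ => -[]. Qed.
Let PG1 p : (P p + G p :=: 1%:M)%MS. Proof. by case: (complG p). Qed.
Let PG0 p : (P p :&: G p)%MS = 0. Proof. by case: (complG p). Qed.

Local Notation Q := (split_proj P G).
Local Notation Theta := (split_omega P G).

Let PQ p : P p *m Q p = P p. Proof. exact: split_PQ. Qed.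
Let PTheta p : P p *m Theta p = - (Q p)^T. Proof. exact: split_PTheta. Qed.
Let ThetaP p : Theta p *m P p = - Q p. Proof. exact: split_ThetaP. Qed.
Let QQ p : Q p *m Q p = Q p. Proof. exact: split_QQ. Qed.
Let ThetaQ p : Theta p *m (Q p)^T = Theta p. Proof. exact: split_ThetaQ. Qed.

Lemma split_good p : (1%:M - Q p)^T *m Z p *m (1%:M - Q p) = 0.
Proof. by apply: good_split => //; case: infZ => _ /(_ p). Qed.

Lemma phi_split p : phi P G Z p = Theta p *m - Z p *m (1%:M - Q p).
Proof. by rewrite /phi (proj_split_compl (PG1 p) (PG0 p)). Qed.

Lemma end_in_phi c q : dom c q -> end_in c q (phi P G Z q) =
  - (cov_in c q (Theta q) *m biv_in c q (Z q)) *m (1%:M - end_in c q (Q q)).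
Proof.
move=> cq; rewrite phi_split end_inM// mulmxN end_inN end_in_cov_biv//.
by rewrite end_inD end_inN end_in1.
Qed.

Lemma smooth_phi : smooth_field (@end_in R n M) setT (phi P G Z).
Proof.
move=> c; have oO := @open_codomI R n M c setT openT.
have S : smooth (cmap c @` (dom c `&` setT)) (fun u =>
    - (rep (@cov_in R n M) c Theta u *m rep (@biv_in R n M) c Z u)
      *m (1%:M - rep (@end_in R n M) c Q u)).
  apply: smooth_mulmx => //.
    apply: smooth_opp => //; apply: smooth_mulmx => //.
    exact: (smooth_split_omega bivP rkP smoothG complG).
  apply: smooth_sub => //; first exact: smooth_cst.
  exact: (smooth_split_proj bivP rkP smoothG complG).
by apply: eq_smooth S => // u /chart_imageP[cu _ _]; rewrite [RHS]end_in_phi.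
Qed.

Section Closed.
Variables (X Y : M -> 'rV[R]_n) (p : M).
Hypotheses (sX : smooth_field (@vec_in R n M 1) setT X)
  (sY : smooth_field (@vec_in R n M 1) setT Y)
  (XP : forall p, (X p <= P p)%MS) (YP : forall p, (Y p <= P p)%MS).

Let c := chart_at p.
Let u0 := cmap c p.
Let cp : dom c p := dom_chart_at p.
Let f := rep (@biv_in R n M) c P.
Let z := rep (@biv_in R n M) c Z.
Let K := 'd z u0.
Let L := 'd f u0.

(* The covector field a with X = aP, and g with aZQ = gP. *)
Let a (S : M -> 'rV[R]_n) u :=
  - (rep (@vec_in R n M 1) c S u *m rep (@cov_in R n M) c Theta u).
Let g (S : M -> 'rV[R]_n) u :=
  - (a S u *m z u *m rep (@end_in R n M) c Q u *m rep (@cov_in R n M) c Theta u).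

Let df : differentiable f u0. Proof. exact: rep_differentiable. Qed.
Let dz : differentiable z u0. Proof. exact: rep_differentiable. Qed.

Let sa S : smooth_field (@vec_in R n M 1) setT S ->
  smooth (cmap c @` (dom c `&` setT)) (a S).
Proof.
move=> sS; have oO := @open_codomI R n M c setT openT.
apply: smooth_opp => //; apply: smooth_mulmx => //.
exact: (smooth_split_omega bivP rkP smoothG complG).
Qed.

Let sg S : smooth_field (@vec_in R n M 1) setT S ->
  smooth (cmap c @` (dom c `&` setT)) (g S).
Proof.
move=> sS; have oO := @open_codomI R n M c setT openT.
apply: smooth_opp => //; apply: smooth_mulmx => //;
  last exact: (smooth_split_omega bivP rkP smoothG complG).
apply: smooth_mulmx => //; last exact: (smooth_split_proj bivP rkP smoothG complG).
by apply: smooth_mulmx => //; exact: sa.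
Qed.

Let u0O : (cmap c @` (dom c `&` setT)) u0. Proof. exact: codom_cmap. Qed.

Let aP S u : (forall p, (S p <= P p)%MS) -> (cmap c @` (dom c `&` setT)) u ->
  rep (@vec_in R n M 1) c S u = a S u *m f u.
Proof.
move=> SP /chart_imageP[cu _ _]; rewrite /a /f /rep mulNmx -mulmxA -end_in_cov_biv//.
rewrite -vec_in_end// ThetaP mulmxN.
have /submxP[w ->] := SP (cinv c u).
by rewrite -mulmxA PQ /vec_in mulNmx opprK.
Qed.

(** phi(Z)(S) is aZ minus its tangential part aZQ. Writing the latter as gP leaves only the
    derivatives of [Z] and [P], which the bracket conditions control; those of Q and Theta are
    absorbed into the derivatives of [a] and [g], which cancel in [phi_closed_form]. *)
Let aE S u : (cmap c @` (dom c `&` setT)) u ->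
  rep (@vec_in R n M 1) c (fun q => S q *m phi P G Z q) u = a S u *m z u - g S u *m f u.
Proof.
move=> /chart_imageP[cu _ _]; set q := rep (@end_in R n M) c Q u.
have thf : rep (@cov_in R n M) c Theta u *m f u = - q.
  by rewrite /f /rep -end_in_cov_biv// ThetaP end_inN.
have qq : q *m q = q by rewrite /q /rep -end_inM// QQ.
have -> : g S u *m f u = a S u *m z u *m q.
  rewrite /g mulNmx -(mulmxA _ (rep _ _ _ _) (f u)) thf mulmxN opprK.
  by rewrite -(mulmxA _ q) qq.
rewrite -[X in X - _]mulmx1 -mulmxBr [LHS]vec_in_end// end_in_phi// mulmxA.
by rewrite /a mulNmx mulmxN mulmxA.
Qed.

Let is_derive_prod (h : 'rV[R]_n -> 'rV[R]_n) (k : 'rV[R]_n -> 'M[R]_n) v :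
  smooth (cmap c @` (dom c `&` setT)) h -> differentiable k u0 ->
  is_derive u0 v (fun u => h u *m k u) ('D_v h u0 *m k u0 + h u0 *m 'd k u0 v).
Proof.
move=> sh dk; have dh := smooth_differentiable sh u0O.
by rewrite -deriveE//; apply: is_derive_mulmx; exact/derivableP/diff_derivable.
Qed.

Let DS S v : smooth_field (@vec_in R n M 1) setT S -> (forall p, (S p <= P p)%MS) ->
  'D_v (rep (@vec_in R n M 1) c S) u0 = 'D_v (a S) u0 *m P p + a S u0 *m L v.
Proof.
move=> sS SP; have D := is_derive_prod v (sa sS) df.
have -> : P p = f u0 by rewrite [RHS]rep_cmap// biv_in_chart_at.
rewrite -(@derive_val _ _ _ _ _ _ _ D); apply: near_eq_derive.
by have := near_codomT cp; apply: filterS => u; exact: aP.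
Qed.

Let DE S v : smooth_field (@vec_in R n M 1) setT S ->
  'D_v (rep (@vec_in R n M 1) c (fun q => S q *m phi P G Z q)) u0 =
  'D_v (a S) u0 *m Z p + a S u0 *m K v - ('D_v (g S) u0 *m P p + g S u0 *m L v).
Proof.
move=> sS; have D := is_deriveB (is_derive_prod v (sa sS) dz)
  (is_derive_prod v (sg sS) df).
have -> : P p = f u0 by rewrite [RHS]rep_cmap// biv_in_chart_at.
have -> : Z p = z u0 by rewrite [RHS]rep_cmap// biv_in_chart_at.
rewrite -(@derive_val _ _ _ _ _ _ _ D); apply: near_eq_derive.
by have := near_codomT cp; apply: filterS => u; exact: aE.
Qed.

Let vec_in_p (v : 'rV[R]_n) : vec_in c p v = v.
Proof. by rewrite /vec_in jac_chart_at mulmx1. Qed.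

Lemma phi_closed_at :
  (lie X (fun q => Y q *m phi P G Z q) p - lie Y (fun q => X q *m phi P G Z q) p
    - lie X Y p *m phi P G Z p <= P p)%MS.
Proof.
have f0 : f u0 = P p by rewrite [LHS]rep_cmap// biv_in_chart_at.
have z0 : z u0 = Z p by rewrite [LHS]rep_cmap// biv_in_chart_at.
have X0 : X p = a X u0 *m P p by rewrite -f0 -aP// rep_cmap// vec_in_p.
have Y0 : Y p = a Y u0 *m P p by rewrite -f0 -aP// rep_cmap// vec_in_p.
have XE : X p *m phi P G Z p = a X u0 *m Z p - g X u0 *m P p.
  by rewrite -f0 -z0 -aE// rep_cmap// vec_in_p.
have YE : Y p *m phi P G Z p = a Y u0 *m Z p - g Y u0 *m P p.
  by rewrite -f0 -z0 -aE// rep_cmap// vec_in_p.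
have skew_df v : (L v)^T = - L v.
  rewrite /L -deriveE//; apply: derive_skew; first exact: diff_derivable.
  exact: near_rep_skew.
have skew_dz v : (K v)^T = - K v.
  rewrite /K -deriveE//; apply: derive_skew; first exact: diff_derivable.
  exact: near_rep_skew.
have jacP i j k : L (row i (P p)) j k + L (row i (P p)) j k
    + (L (row j (P p)) k i + L (row j (P p)) k i)
    + (L (row k (P p)) i j + L (row k (P p)) i j) = 0.
  by have [_ + _] := poissonP => /(_ p i j k); rewrite schoutenE.
have jacZ i j k : K (row i (P p)) j k + L (row i (Z p)) j k
    + (K (row j (P p)) k i + L (row j (Z p)) k i)
    + (K (row k (P p)) i j + L (row k (Z p)) i j) = 0.
  by have [_ _ +] := infZ => /(_ p i j k); rewrite schoutenE.
apply: submx_tested => w Pw.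
have := phi_closed_form ('D_(Y p) (a X) u0) ('D_(X p) (a Y) u0)
  ('D_(X p *m phi P G Z p) (a Y) u0) ('D_(Y p *m phi P G Z p) (a X) u0)
  ('D_(Y p) (g X) u0) ('D_(X p) (g Y) u0)
  (skewP p) (skewZ p) (PTheta p) (ThetaP p) (PQ p)
  (ThetaQ p) (split_good p) skew_dz skew_df jacP jacZ XE YE Pw.
rewrite -X0 -Y0 -phi_split => <-.
rewrite /lie -/c -/u0 (DE _ sY) (DE _ sX) (DS _ sX XP) (DS _ sY YP).
by rewrite (DS _ sY YP) (DS _ sX XP).
Qed.

End Closed.

Lemma phi_fol_inf_def : fol_inf_def P G (phi P G Z).
Proof.
split; first exact: smooth_phi; last first.
  by move=> X Y sX sY XP YP p; exact: phi_closed_at.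
by move=> p; have [] := phiP (skewP p) complG Z.
Qed.

End Phi.

(** * The lifted path *)

Section Lift.
Context (R : realType) (n : nat) (M : manifold R n) (P G Z : M -> 'M[R]_n).
Hypotheses (poissonP : regular_poisson 2 P)
  (smoothG : smooth_distribution (n - 2) G) (complG : complementary P G)
  (infZ : poisson_inf_def P Z).

Let bivP : bivector_field P. Proof. by case: poissonP. Qed.
Let rkP p : \rank (P p) = 2%N. Proof. by case: poissonP. Qed.
Let skewP p : (P p)^T = - P p. Proof. by case: bivP. Qed.
Let sP : smooth_field (@biv_in R n M) setT P. Proof. by case: bivP. Qed.
Let skewZ p : (Z p)^T = - Z p. Proof. by case: infZ => -[]. Qed.
Let sZ : smooth_field (@biv_in R n M) setT Z. Proof. by case: infZ => -[]. Qed.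

Local Notation Q := (split_proj P G).
Local Notation Theta := (split_omega P G).

Definition tangential_part p : 'M[R]_n := (Q p)^T *m Z p *m Q p.
Local Notation V := tangential_part.

Definition tangential_square p : 'M[R]_n := V p *m (Theta p *m V p).
Local Notation W := tangential_square.

Let PTheta p : P p *m Theta p = - (Q p)^T.
Proof. exact: split_PTheta. Qed.
Let ThetaP p : Theta p *m P p = - Q p.
Proof. exact: split_ThetaP. Qed.

(* Pointwise V = f P and W = - f^2 P, so that this is (1 + t f + t^2 f^2) P. *)
Definition tangential_path t p : 'M[R]_n := P p + t *: (V p - t *: W p).

Lemma tangential_path_scale t p :
  exists2 a, a != 0 & tangential_path t p = a *: P p.
Proof.
have [f VE WE] := tangential_scale (skewP p) (skewZ p) (ThetaP p)
  (split_PQ complG p) (rkP p).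
exists (1 + t * f + (t * f) ^+ 2).
  have : 0 < 1 + t * f + (t * f) ^+ 2 by set x := t * f; nra.
  by rewrite lt_def => /andP[].
rewrite /tangential_path /W /V WE VE !scalerA -scalerBl scalerA.
rewrite -[X in X + _]scale1r -scalerDl.
by congr (_ *: _); ring.
Qed.

Lemma smooth_tangential_part : smooth_field (@biv_in R n M) setT V.
Proof.
move=> c; have oO := @open_codomI R n M c setT openT.
have sQ := smooth_split_proj bivP rkP smoothG complG c.
have S : smooth (cmap c @` (dom c `&` setT)) (fun u =>
    (rep (@end_in R n M) c Q u)^T *m rep (@biv_in R n M) c Z u
      *m rep (@end_in R n M) c Q u).
  apply: smooth_mulmx => //; apply: smooth_mulmx => //; exact: smooth_trmx.
by apply: eq_smooth S => // u /chart_imageP[cu _ _]; rewrite [RHS]biv_in_conj.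
Qed.

Lemma smooth_tangential_square : smooth_field (@biv_in R n M) setT W.
Proof.
move=> c; have oO := @open_codomI R n M c setT openT.
have sV := smooth_tangential_part c.
have sTh := smooth_split_omega bivP rkP smoothG complG c.
have S : smooth (cmap c @` (dom c `&` setT)) (fun u =>
    rep (@biv_in R n M) c V u
      *m (rep (@cov_in R n M) c Theta u *m rep (@biv_in R n M) c V u)).
  by apply: smooth_mulmx => //; exact: smooth_mulmx.
apply: eq_smooth S => // u /chart_imageP[cu _ _].
by rewrite [RHS]biv_in_end// end_in_cov_biv.
Qed.

Variable eta_ : R -> M -> 'M[R]_n.

Definition lifted_path t p : 'M[R]_n :=
  (1%:M + eta_ t p)^T *m tangential_path t p *m (1%:M + eta_ t p).

Section AtTime.
Variable t : R.
Hypothesis etaG : forall p, hom_at G p (eta_ t p).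

(** [eta_ t p] takes values in G and vanishes on G, so it squares to zero; its size does not
    matter. *)
Lemma graph_unit p : 1%:M + eta_ t p \in unitmx.
Proof.
have [Geta /submxP[x etaE]] := etaG p.
have eta2 : eta_ t p *m eta_ t p = 0 by rewrite {1}etaE -mulmxA Geta mulmx0.
have : (1%:M + eta_ t p) *m (1%:M - eta_ t p) = 1%:M.
  by rewrite mulmxBr mulmx1 mulmxDl mul1mx eta2 addr0 addrK.
by move=> H; have [] := mulmx1_unit H.
Qed.

Lemma lifted_path_image p : (lifted_path t p :=: P p *m (1%:M + eta_ t p))%MS.
Proof.
rewrite /lifted_path; have [a a0 ->] := tangential_path_scale t p.
rewrite -mulmxA; apply: eqmx_trans (eqmxMfull _ _) _.
  by rewrite row_full_unit unitmx_tr graph_unit.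
by rewrite -scalemxAl; exact: eqmx_scale.
Qed.

Lemma lifted_path_rank p : \rank (lifted_path t p) = 2%N.
Proof.
by rewrite lifted_path_image mxrankMfree ?rkP// row_free_unit graph_unit.
Qed.

Lemma lifted_path_skew p : (lifted_path t p)^T = - lifted_path t p.
Proof.
rewrite /lifted_path; have [a a0 ->] := tangential_path_scale t p.
by rewrite !trmx_mul trmxK linearZ /= skewP scalerN mulNmx mulmxN mulmxA.
Qed.

End AtTime.

Lemma rep_lifted_path c t u : (cmap c @` (dom c `&` setT)) u ->
  rep (@biv_in R n M) c (lifted_path t) u =
  (1%:M + rep (@end_in R n M) c (eta_ t) u)^T
  *m (rep (@biv_in R n M) c P u
      + t *: (rep (@biv_in R n M) c V u - t *: rep (@biv_in R n M) c W u))
  *m (1%:M + rep (@end_in R n M) c (eta_ t) u).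
Proof.
move=> /chart_imageP[cu _ _]; rewrite [LHS]biv_in_conj// end_inD end_in1//.
congr (_ *m _ *m _); rewrite /tangential_path /rep /biv_in.
rewrite mulmxDr mulmxDl -scalemxAr -scalemxAl mulmxBr mulmxBl.
by rewrite -scalemxAr -scalemxAl.
Qed.

Lemma smooth_lifted_path (d : R) :
  smooth_path (@end_in R n M) [set t | `|t| < d] setT eta_ ->
  smooth_path (@biv_in R n M) [set t | `|t| < d] setT lifted_path.
Proof.
move=> seta c; have oO := @open_codomI R n M c setT openT.
have oJ := @open_normr_lt R d.
have oJO := @open_rectangle R^o _ _ _ oJ oO.
set O := cmap c @` (dom c `&` setT) in oO oJO *.
have sA : @smooth R (R^o * 'rV[R]_n)%type _ ([set t | `|t| < d] `*` O)
    (fun tu => 1%:M + rep (@end_in R n M) c (eta_ tu.1) tu.2).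
  by apply: smooth_add => //; [exact: smooth_cst|exact (seta c)].
have sT := smooth_time oJ oO.
have sB S : smooth O (rep (@biv_in R n M) c S) ->
    @smooth R (R^o * 'rV[R]_n)%type _ ([set t | `|t| < d] `*` O)
      (fun tu => rep (@biv_in R n M) c S tu.2).
  exact: smooth_snd.
have S : @smooth R (R^o * 'rV[R]_n)%type _ ([set t | `|t| < d] `*` O) (fun tu =>
    (1%:M + rep (@end_in R n M) c (eta_ tu.1) tu.2)^T
    *m (rep (@biv_in R n M) c P tu.2
        + tu.1 *: (rep (@biv_in R n M) c V tu.2 - tu.1 *: rep (@biv_in R n M) c W tu.2))
    *m (1%:M + rep (@end_in R n M) c (eta_ tu.1) tu.2)).
  apply: (smooth_mulmx oJO) => //; apply: (smooth_mulmx oJO); first exact: smooth_trmx.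
  apply: smooth_add => //; first exact/sB/sP.
  apply: smooth_scale => //; apply: smooth_sub => //.
    exact/sB/smooth_tangential_part.
  by apply: smooth_scale => //; exact/sB/smooth_tangential_square.
by apply: eq_smooth S => // -[t u] [/= _ Ou]; rewrite rep_lifted_path.
Qed.

Lemma lifted_path0 p : eta_ 0 p = 0 -> lifted_path 0 p = P p.
Proof.
move=> e0; rewrite /lifted_path /tangential_path e0 addr0 trmx1 mul1mx mulmx1.
by rewrite scale0r addr0.
Qed.

Lemma is_derive_lifted_path p : eta_ 0 p = 0 ->
  is_derive (0 : R) 1 (fun t => eta_ t p) (phi P G Z p) ->
  is_derive (0 : R) 1 (fun t => lifted_path t p) (Z p).
Proof.
move=> e0 De.
have DA : is_derive (0 : R) 1 (fun t => 1%:M + eta_ t p) (0 + phi P G Z p).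
  exact: is_deriveD.
have DC : is_derive (0 : R) 1 (fun t => tangential_path t p) (V p).
  have D1 := is_derive_mulmx (is_derive_scalel (1%:M : 'M[R]_n) 0)
    (is_deriveB (is_derive_cst (V p) (0 : R) 1) (is_derive_scalel (W p) 0)).
  (* The factor [t] is written as the matrix t 1 so that the matrix product rule applies; at t = 0
     only V survives. *)
  have -> : (fun t => tangential_path t p) =
      cst (P p) + (fun t : R => (t *: 1%:M) *m (cst (V p) - *:%R^~ (W p)) t).
    by apply/funext => t; rewrite /tangential_path -[in LHS](mul1mx (_ - _)) scalemxAl.
  apply: is_derive_eq (is_deriveD (is_derive_cst (P p) (0 : R) 1) D1) _.
  by rewrite add0r scale0r mul0mx addr0 mul1mx !fctE scale0r subr0.
have := is_derive_mulmx (is_derive_mulmx (is_derive_trmx DA) DC) DA.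
move=> D; apply: is_derive_eq D _; rewrite e0 addr0 trmx1 !mul1mx mulmx1 add0r.
rewrite /tangential_path scale0r addr0 (phi_split Z complG).
exact: lift_derivative (skewP p) (skewZ p) (PTheta p) (split_good complG infZ p).
Qed.

End Lift.

Lemma poisson_unobstructed_of_phi (R : realType) (n : nat) (M : manifold R n)
    (P G Z : M -> 'M[R]_n) :
  regular_poisson 2 P -> smooth_distribution (n - 2) G -> complementary P G ->
  poisson_inf_def P Z ->
  fol_unobstructed 2 P G (phi P G Z) -> poisson_unobstructed 2 P Z.
Proof.
move=> poissonP smoothG complG infZ.
move=> [e [D [e0 [Dinv _] D0 [d [eta_ [/andP[d0 de] seta etaG DE Deta]]]]]].
(* Known at first is only that TF is the graph of [eta_ 0]. Hence P eta_0 = P (1 + eta_0) - P has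
   its rows in TF as well as in G, so it is zero. *)
have eta0 p : eta_ 0 p = 0.
  have t0 : `|0 : R| < d by rewrite normr0.
  have [PG1 PG0] := complG p; have [Geta etaSG] := etaG 0 p t0.
  apply: (eq_on_splitting PG1); rewrite mulmx0; last exact: Geta.
  apply/eqP; rewrite -submx0 -PG0 sub_capmx (submx_trans (submxMl _ _) etaSG) andbT.
  have -> : P p *m eta_ 0 p = P p *m (1%:M + eta_ 0 p) - P p.
    by rewrite mulmxDr mulmx1 addrC addKr.
  rewrite addmx_sub ?eqmx_opp ?submx_refl//.
  by rewrite -(DE 0 p t0) (D0 p) submx_refl.
have slift := smooth_lifted_path poissonP smoothG complG infZ seta.
(* The interval of [eta_] serves unchanged, the conformal factor being positive at every time. *)
exists d, (lifted_path P G Z eta_); split.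
- exact: d0.
- exact: slift.
- move=> t td; have etaGt p : hom_at G p (eta_ t p) by exact: etaG.
  have rk := lifted_path_rank poissonP complG infZ etaGt.
  have biv : bivector_field (lifted_path P G Z eta_ t).
    split=> [p|c]; first exact: lifted_path_skew.
    have oO := @open_codomI R n M c setT openT.
    have S := smooth_slice oO td (slift c).
    exact: S.
  split=> //; apply: (involutive_schouten biv rk (D := D t)).
    move=> p; apply: eqmx_trans (DE t p td) _; apply: eqmx_sym.
    exact: lifted_path_image.
  by apply: Dinv; exact: lt_le_trans td de.
- by move=> p; exact: lifted_path0.
- by move=> p; apply: is_derive_lifted_path => //; exact: Deta.
Qed.

Theorem proposition6p13 (R : realType) (n : nat) (M : manifold R n)
    (P G : M -> 'M[R]_n)
    (compactM : compact [set: M])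
    (poissonP : regular_poisson 2 P)
    (smoothG : smooth_distribution (n - 2) G)
    (complG : complementary P G) :
  (forall Z : M -> 'M[R]_n, poisson_inf_def P Z ->
     fol_unobstructed 2 P G (phi P G Z) -> poisson_unobstructed 2 P Z) /\
  (fol_problem_unobstructed 2 P G -> poisson_problem_unobstructed 2 P).
Proof.
have main Z : poisson_inf_def P Z ->
    fol_unobstructed 2 P G (phi P G Z) -> poisson_unobstructed 2 P Z.
  exact: poisson_unobstructed_of_phi.
split=> [|foliation_unobstructed Z infZ]; first exact: main.
by apply: main => //; apply: foliation_unobstructed; exact: phi_fol_inf_def.
Qed.
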